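(* Let $\{\mathfrak A_k\}_k$ be a multiplicative sequence of polynomial ideals. Then $\{\mathfrak A_k^{min}\}_k$ and $\{\mathfrak A_k^{max}\}_k$ are multiplicative sequences.
   Context: All Banach spaces are complex. $\mathcal P^k(E)$ is the Banach space of continuous $k$-homogeneous polynomials $E\to\mathbb C$; $\check P$ is the symmetric $k$-linear form of $P\in\mathcal P^k(E)$, and for $a\in E$, $P_a(x)=\check P(a,x,\dots,x)$. A Banach ideal of (scalar valued continuous) $k$-homogeneous polynomials is a pair $(\mathfrak A_k,\|\cdot\|_{\mathfrak A_k})$ such that: (i) for every Banach space $E$, $\mathfrak A_k(E)=\mathfrak A_k\cap\mathcal P^k(E)$ is a linear subspace of $\mathcal P^k(E)$ and $(\mathfrak A_k(E),\|\cdot\|_{\mathfrak A_k(E)})$ is a Banach space; (ii) if $T\in\mathcal L(E_1,E)$ and $P\in\mathfrak A_k(E)$ then $P\circ T\in\mathfrak A_k(E_1)$ and $\|P\circ T\|_{\mathfrak A_k(E_1)}\le\|P\|_{\mathfrak A_k(E)}\|T\|^k$; (iii) $z\mapsto z^k$ belongs to $\mathfrak A_k(\mathbb C)$ and has norm 1. A sequence $\{\mathfrak A_k\}_{k\ge1}$ of such ideals is coherent if there are constants $C,D>0$ such that for every Banach space $E$ and $k\in\mathbb N$: $P\in\mathfrak A_{k+1}(E)$, $a\in E$ imply $P_a\in\mathfrak A_k(E)$ and $\|P_a\|_{\mathfrak A_k(E)}\le C\|P\|_{\mathfrak A_{k+1}(E)}\|a\|$; and $P\in\mathfrak A_k(E)$,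 $\gamma\in E'$ imply $\gamma P\in\mathfrak A_{k+1}(E)$ and $\|\gamma P\|_{\mathfrak A_{k+1}(E)}\le D\|\gamma\|\|P\|_{\mathfrak A_k(E)}$. It is multiplicative if it is coherent and there is a constant $M$ such that for all $k,l$, every Banach space $E$, $P\in\mathfrak A_k(E)$, $Q\in\mathfrak A_l(E)$, one has $PQ\in\mathfrak A_{k+l}(E)$ and $\|PQ\|_{\mathfrak A_{k+l}(E)}\le M^{k+l}\|P\|_{\mathfrak A_k(E)}\|Q\|_{\mathfrak A_l(E)}$. The maximal hull of $\mathfrak A_k$ is $\mathfrak A_k^{max}(E)=\{P\in\mathcal P^k(E):\|P\|_{\mathfrak A_k^{max}(E)}=\sup_N\|P|_N\|_{\mathfrak A_k(N)}<\infty\}$, supremum over finite dimensional subspaces $N\subset E$. The minimal hull is $\mathfrak A_k^{min}=\mathfrak A_k^{max}\circ\overline{\mathcal F}$, with $\overline{\mathcal F}$ the ideal of approximable operators (operator norm closure of finite rank operators): $P\in\mathfrak A_k^{min}(E)$ iff $P=Q\circ T$ with $T\in\overline{\mathcal F}(E,E_1)$, $Q\in\mathfrak A_k^{max}(E_1)$ for some Banach space $E_1$, with norm $\inf\|Q\|_{\mathfrak A_k^{max}(E_1)}\|T\|^k$ over all such factorizations. These are the largest and the smallest Banach polynomial ideals coinciding isometrically with $\mathfrak A_k$ on finite dimensional spaces. *)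

(* Defs.v *)
From HB Require Import structures.
From mathcomp Require Import all_boot all_order all_algebra.
From mathcomp Require Import perm complex.
From mathcomp Require Import all_classical all_reals.
From mathcomp Require Import ereal topology normedtype.

Set Implicit Arguments.
Unset Strict Implicit.
Unset Printing Implicit Defensive.

Import Order.TTheory GRing.Theory Num.Theory.
Import numFieldTopology.Exports numFieldNormedType.Exports.

Local Open Scope classical_set_scope.
Local Open Scope ring_scope.
Local Open Scope complex_scope.

HB.instance Definition _ (R : realType) := NormedModule.copy R[i] (R[i])^o.

Lemma complex_complete (R : realType) (F : set_system (R[i])) :
  ProperFilter F -> cauchy F -> cvg F.
Proof.
move=> FF /cauchy_ballP cF.
have cP (f : R[i] -> R) : (forall x y : R[i], (`|f x - f y|)%:C <= `|x - y|) ->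
    cauchy (f @ F).
  move=> fle; apply/cauchy_ballP => e e0.
  have e0' : (0 : R[i]) < e%:C by rewrite ltcR.
  rewrite near_map2; have := cF _ e0'.
  apply: filterS => -[x y] /=.
  rewrite -!ball_normE /= => xy.
  by rewrite -ltcR (le_lt_trans (fle _ _)).
have leRe (z : R[i]) : (`|complex.Re z|)%:C <= `|z|.
  by case: z => a b; rewrite normc_def lecR /= -sqrtr_sqr ler_wsqrtr // lerDl sqr_ge0.
have leIm (z : R[i]) : (`|complex.Im z|)%:C <= `|z|.
  by case: z => a b; rewrite normc_def lecR /= -sqrtr_sqr ler_wsqrtr // lerDr sqr_ge0.
have cRe : cauchy ((@complex.Re R : R[i] -> R) @ F).
  by apply: cP => x y; rewrite -raddfB; exact: leRe.
have cIm : cauchy ((@complex.Im R : R[i] -> R) @ F).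
  by apply: cP => x y; rewrite -raddfB; exact: leIm.
have /cvg_ex[a /= /cvgrPdist_lt Fa] : cvg (@complex.Re R @ F) by exact: R_complete cRe.
have /cvg_ex[b /= /cvgrPdist_lt Fb] : cvg (@complex.Im R @ F) by exact: R_complete cIm.
apply/cvg_ex; exists (a +i* b : R[i]); apply/cvgrPdist_lt => e e0.
have [eR e0'] : e = (complex.Re e)%:C /\ 0 < complex.Re e.
  by case: e e0 => p q; rewrite ltcE /= => /andP[/eqP -> ->].
have h0 : 0 < complex.Re e / 2 by rewrite divr_gt0.
near=> z.
have -> : a +i* b - z = (a - complex.Re z)%:C + (0 +i* (b - complex.Im z)).
  by case: (z) => p q; simpc.
rewrite eR (le_lt_trans (ler_normD _ _)) // !normc_def /=.
rewrite !expr0n /= addr0 add0r !sqrtr_sqr -rmorphD /= ltcR [ltRHS]splitr ltrD //.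
  by near: z; exact: Fa.
by near: z; exact: Fb.
Unshelve. all: by end_near. Qed.

HB.instance Definition _ (R : realType) :=
  Uniform_isComplete.Build R[i] (@complex_complete R).

Definition in_span (K : pzRingType) (E : lmodType K) (s : seq E) (x : E) : Prop :=
  exists c : nat -> K, x = \sum_(i < size s) c i *: s`_i.

Section Span.
Variables (R : realType) (E : normedModType R[i]).

Lemma in_span_submod (s : seq E) : submod_closed [pred x | `[< in_span s x >]].
Proof.
split=> [|c x y /asboolP[f ->] /asboolP[g ->]].
  by apply/asboolP; exists (fun=> 0); rewrite big1 // => i _; rewrite scale0r.
apply/asboolP; exists (fun i => c * f i + g i).
rewrite scaler_sumr -big_split; apply: eq_bigr => i _ /=.
by rewrite scalerDl scalerA.
Qed.

Lemma in_span_cons (s : seq E) (a x : E) :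
  in_span (a :: s) x <-> exists c, in_span s (x - c *: a).
Proof.
split=> [[f ->]|[c [f fE]]].
  exists (f 0%N), (fun i => f i.+1).
  by rewrite big_ord_recl /= addrC addKr.
exists (fun i => if i is j.+1 then f j else c).
by rewrite big_ord_recl /= -fE addrC subrK.
Qed.

(* Adding one vector a to a closed subspace F keeps it closed: the coefficient of
   a is a bounded functional when a is not in F *)
Lemma closed_in_span (s : seq E) : closed [set x | in_span s x].
Proof.
elim: s => [|a s IH].
  rewrite (_ : [set x | _] = [set 0]); first exact/accessible_closed_set1/hausdorff_accessible/norm_hausdorff.
  apply/seteqP; split=> [x [f ->]|x ->]; first by rewrite big_ord0.
  by exists (fun=> 0); rewrite big_ord0.
have [sub0 subD] := in_span_submod s.
have sD c x y : in_span s x -> in_span s y -> in_span s (c *: x + y).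
  by move=> sx sy; apply/asboolP/(subD c x y); apply/asboolP.
have s0 : in_span s 0 by exact/asboolP.
have sB x y : in_span s x -> in_span s y -> in_span s (x - y).
  by move=> sx sy; have := sD (-1) y x sy sx; rewrite scaleN1r addrC.
have sZ c x : in_span s x -> in_span s (c *: x).
  by move=> sx; rewrite -[_ *: _]addr0; exact: sD.
have [sa|nsa] := pselect (in_span s a).
  rewrite (_ : [set x | _] = [set x | in_span s x]) //.
  apply/seteqP; split=> x /=.
    by move/in_span_cons => [c h]; rewrite -[x](subrK (c *: a)) addrC; exact: sD.
  by move=> sx; apply/in_span_cons; exists 0; rewrite scale0r subr0.
have [d d0 dP] : exists2 d : R[i], 0 < d & forall y, in_span s y -> d <= `|a - y|.
  have oC : open (~` [set x | in_span s x]) by exact: closed_openC.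
  have : nbhs a (~` [set x | in_span s x]) by exact: open_nbhs_nbhs.
  move=> /nbhs_ballP[d /= d0 dP]; exists d => // y sy.
  rewrite real_leNgt ?normr_real ?gtr0_real //; apply/negP => lt.
  by apply: (dP y) => //; rewrite -ball_normE.
have coef c v : in_span s v -> `|c| * d <= `|c *: a - v|.
  have [->|c0] := eqVneq c 0; first by rewrite normr0 mul0r.
  move=> sy; rewrite -[v](scalerKV c0) -scalerBr normrZ ler_pM2l ?normr_gt0 //.
  by apply: dP; exact: sZ.
pose k x : R[i] := xget 0 [set c | in_span s (x - c *: a)].
have kP x : in_span (a :: s) x -> in_span s (x - k x *: a).
  by case/in_span_cons => c sc; rewrite /k; case: xgetP => [? _ //|/(_ c)].
set V := [set x | in_span (a :: s) x].
move=> x clx.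
pose G : set_system E := within V (nbhs x).
have GF : ProperFilter G by exact: within_nbhs_proper.
have GV : G V by exact: withinT.
have kcont u v : V u -> V v -> `|k u - k v| * d <= `|u - v|.
  move=> Vu Vv.
  have -> : u - v = (k u - k v) *: a - ((v - k v *: a) - (u - k u *: a)).
    by rewrite scalerBl opprB addrACA -opprD ![_ *: a + _]addrC !subrK.
  by apply: coef; apply: sB; exact: kP.
have ck : cauchy (k @ G).
  apply/cauchy_ballP => e e0; rewrite near_map2.
  have ed0 : 0 < e * d / 2 by rewrite divr_gt0 // mulr_gt0.
  have Gb : G (ball x (e * d / 2) `&` V).
    by apply: filterS (nbhsx_ballx x _ ed0) => u xu Vu; split.
  exists (ball x (e * d / 2) `&` V, ball x (e * d / 2) `&` V) => //.
  move=> [u v] /= [[xu Vu] [xv Vv]].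
  rewrite -ball_normE /= -(ltr_pM2r d0) (le_lt_trans (kcont _ _ Vu Vv)) //.
  by move: (ball_splitr xu xv); rewrite -ball_normE.
have /cvg_ex[c /= kc] : cvg (k @ G) by exact: complex_complete ck.
apply/in_span_cons; exists c.
have gc : (fun u => u - k u *: a) @ G --> x - c *: a.
  apply: cvgB; first exact: cvg_within.
  by apply: cvgZr_tmp.
have nG : \forall u \near G, in_span s (u - k u *: a).
  by apply: filterS GV => u; exact: kP.
exact: (closed_cvg _ IH nG _ gc).
Qed.

End Span.

Record fdsubspace (R : realType) (E : normedModType R[i]) := FDSubspace {
  fds_pred : E -> bool;
  fds_span : exists s : seq E, forall x, (x \in fds_pred) <-> in_span s x }.

(* The elements of N; the norm put on this type below is the norm of E. *)
Record fds_type (R : realType) (E : normedModType R[i]) (N : fdsubspace E) :=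
  FDSElt { fds_val : E; _ : fds_val \in fds_pred N }.

Section FDSubspaceNormed.
Variables (R : realType) (E : normedModType R[i]) (N : fdsubspace E).

HB.instance Definition _ := [isSub of fds_type N for @fds_val R E N].
HB.instance Definition _ := [Choice of fds_type N by <:].

Lemma fds_submod_closed : submod_closed (fds_pred N).
Proof.
have [s sP] := fds_span N; have [s0 sD] := in_span_submod s.
split=> [|c x y /sP xN /sP yN]; apply/sP; apply/asboolP => //.
by apply: sD; exact/asboolP.
Qed.

HB.instance Definition _ :=
  GRing.isSubmodClosed.Build R[i] E (fds_pred N) fds_submod_closed.
HB.instance Definition _ := [SubChoice_isSubLmodule of fds_type N by <:].

Let norm (x : fds_type N) : R[i] := `|val x|.

Let ler_normD x y : norm (x + y) <= norm x + norm y.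
Proof. by rewrite /norm raddfD ler_normD. Qed.

Let normZ c x : norm (c *: x) = `|c| * norm x.
Proof. by rewrite /norm linearZ normrZ. Qed.

Let norm0_eq0 x : norm x = 0 -> x = 0.
Proof. by move=> /normr0_eq0 x0; apply: val_inj; rewrite x0 raddf0. Qed.

HB.instance Definition _ :=
  Lmodule_isNormed.Build R[i] (fds_type N) ler_normD normZ norm0_eq0.

Lemma fds_normE (x : fds_type N) : `|x| = `|val x|.
Proof. by []. Qed.

End FDSubspaceNormed.

Section FDSubspaceComplete.
Variables (R : realType) (E : completeNormedModType R[i]) (N : fdsubspace E).

Lemma fds_complete (F : set_system (fds_type N)) :
  ProperFilter F -> cauchy F -> cvg F.
Proof.
move=> FF /cauchy_ballP cF.
have cE : cauchy (val @ F : set_system E).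
  apply/cauchy_ballP => e e0; rewrite near_map2.
  by apply: filterS (cF _ e0) => -[x y]; rewrite -!ball_normE /= fds_normE raddfB.
have /cvg_ex[l /= Fl] : cvg (val @ F : set_system E) by exact: cauchy_cvg cE.
have lN : l \in fds_pred N.
  have [s sP] := fds_span N; apply/sP.
  have nF : \forall x \near F, in_span s (val x).
    by apply: filterE => x; apply/sP; exact: valP.
  exact: (closed_cvg _ (closed_in_span (s := s)) nF _ Fl).
apply/cvg_ex; exists (FDSElt lN); apply/cvgrPdist_lt => e e0.
move/cvgrPdist_lt : Fl => /(_ _ e0); apply: filterS => x.
by rewrite fds_normE raddfB.
Qed.

HB.instance Definition _ := Uniform_isComplete.Build (fds_type N) fds_complete.

End FDSubspaceComplete.

(* Norms of a normedModType R[i] take their values in R[i]; rnorm is the real-valued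
   version. *)
Definition rnorm (R : realType) (E : normedModType R[i]) (x : E) : R :=
  complex.Re `|x|.

Definition opnorm (R : realType) (E F : normedModType R[i]) (T : E -> F) : R :=
  sup [set rnorm (T x) | x in [set x | rnorm x <= 1]].

Section Polynomials.
Variables (R : realType) (E : normedModType R[i]).

Definition klinear (k : nat) (L : ('I_k -> E) -> R[i]) : Prop :=
  forall (x : 'I_k -> E) (i : 'I_k), linear (fun y => L [eta x with i |-> y]).

Definition ksymmetric (k : nat) (L : ('I_k -> E) -> R[i]) : Prop :=
  forall (x : 'I_k -> E) (s : {perm 'I_k}), L (x \o s) = L x.

Definition hpoly (k : nat) (P : E -> R[i]) : Prop :=
  continuous P /\
  exists L : ('I_k -> E) -> R[i], klinear L /\ forall x, P x = L (fun=> x).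

Definition is_polar (k : nat) (P : E -> R[i]) (L : ('I_k -> E) -> R[i]) : Prop :=
  [/\ klinear L, ksymmetric L & forall x, L (fun=> x) = P x].

(* For P in hpoly k there is exactly one L with is_polar P L, by symmetrization and
   the polarization formula; the default value 0 is then not used. *)
Definition polar (k : nat) (P : E -> R[i]) : ('I_k -> E) -> R[i] :=
  xget (fun=> 0) [set L | is_polar P L].

(* The polynomial P_a of degree k, for P of degree k.+1. *)
Definition poly_at (k : nat) (P : E -> R[i]) (a x : E) : R[i] :=
  @polar k.+1 P [eta (fun=> x) with ord0 |-> a].

End Polynomials.

(* The value of pi_norm A E P is irrelevant unless pi_mem A E P. *)
Record poly_ideal (R : realType) := PolyIdeal {
  pi_mem : forall E : completeNormedModType R[i], set (E -> R[i]);
  pi_norm : forall E : completeNormedModType R[i], (E -> R[i]) -> R }.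

Arguments pi_mem {R} _ _ _.
Arguments pi_norm {R} _ _ _.

Definition banach_normed (R : realType) (E : Type) (V : set (E -> R[i]))
    (N : (E -> R[i]) -> R) : Prop :=
  [/\ [/\ V 0, (forall P Q, V P -> V Q -> V (P + Q)) &
          (forall (c : R[i]) P, V P -> V (c *: P))],
      [/\ (forall P, V P -> 0 <= N P), (forall P, V P -> N P = 0 -> P = 0),
          (forall (c : R[i]) P, V P -> N (c *: P) = rnorm c * N P) &
          (forall P Q, V P -> V Q -> N (P + Q) <= N P + N Q)] &
      forall u : nat -> (E -> R[i]), (forall n, V (u n)) ->
        (forall e : R, 0 < e -> exists n0 : nat, forall m n : nat,
          (n0 <= m)%N -> (n0 <= n)%N -> N (u m - u n) < e) ->
        exists2 P, V P & N (u n - P) @[n --> \oo] --> (0 : R)].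

Definition banach_ideal (R : realType) (k : nat) (A : poly_ideal R) : Prop :=
  [/\ forall E : completeNormedModType R[i],
        pi_mem A E `<=` @hpoly R E k /\ banach_normed (pi_mem A E) (pi_norm A E),
      forall (E1 E : completeNormedModType R[i]) (T : {linear E1 -> E}) (P : E -> R[i]),
        continuous T -> pi_mem A E P ->
        pi_mem A E1 (P \o T) /\
        pi_norm A E1 (P \o T) <= pi_norm A E P * opnorm T ^+ k &
      pi_mem A R[i] (fun z => z ^+ k) /\ pi_norm A R[i] (fun z => z ^+ k) = 1].

Definition coherent (R : realType) (A : nat -> poly_ideal R) : Prop :=
  (forall k, (1 <= k)%N -> banach_ideal k (A k)) /\
  exists C D : R, [/\ 0 < C, 0 < D &
    forall (E : completeNormedModType R[i]) (k : nat), (1 <= k)%N ->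
      (forall (P : E -> R[i]) (a : E), pi_mem (A k.+1) E P ->
         pi_mem (A k) E (poly_at k P a) /\
         pi_norm (A k) E (poly_at k P a) <= C * pi_norm (A k.+1) E P * rnorm a) /\
      (forall (P : E -> R[i]) (g : {linear E -> R[i]}), continuous g ->
         pi_mem (A k) E P ->
         pi_mem (A k.+1) E (fun x => g x * P x) /\
         pi_norm (A k.+1) E (fun x => g x * P x) <=
           D * opnorm g * pi_norm (A k) E P)].

Definition multiplicative (R : realType) (A : nat -> poly_ideal R) : Prop :=
  coherent A /\
  exists M : R, forall (k l : nat), (1 <= k)%N -> (1 <= l)%N ->
    forall (E : completeNormedModType R[i]) (P Q : E -> R[i]),
      pi_mem (A k) E P -> pi_mem (A l) E Q ->
      pi_mem (A (k + l)%N) E (fun x => P x * Q x) /\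
      pi_norm (A (k + l)%N) E (fun x => P x * Q x) <=
        M ^+ (k + l) * pi_norm (A k) E P * pi_norm (A l) E Q.

(* The norm of A, with value +oo outside of A. *)
Definition pi_enorm (R : realType) (A : poly_ideal R)
    (E : completeNormedModType R[i]) (P : E -> R[i]) : \bar R :=
  if `[< pi_mem A E P >] then (pi_norm A E P)%:E else +oo%E.

Definition max_enorm (R : realType) (A : poly_ideal R)
    (E : completeNormedModType R[i]) (P : E -> R[i]) : \bar R :=
  ereal_sup [set pi_enorm A (P \o (val : fds_type N -> E)) | N in [set: fdsubspace E]].

Definition max_hull (R : realType) (k : nat) (A : poly_ideal R) : poly_ideal R :=
  {| pi_mem := fun E => [set P | hpoly k P /\ (max_enorm A P < +oo)%E];
     pi_norm := fun E P => fine (max_enorm A P) |}.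

Definition finite_rank (R : realType) (E F : normedModType R[i]) (T : E -> F) : Prop :=
  exists s : seq F, forall x, in_span s (T x).

Definition approximable (R : realType) (E F : normedModType R[i])
    (T : {linear E -> F}) : Prop :=
  continuous T /\
  forall e : R, 0 < e -> exists S : {linear E -> F},
    [/\ continuous S, finite_rank S & opnorm (fun x => T x - S x) < e].

Definition min_hull (R : realType) (k : nat) (A : poly_ideal R) : poly_ideal R :=
  {| pi_mem := fun E => [set P |
       exists (E1 : completeNormedModType R[i]) (T : {linear E -> E1}) (Q : E1 -> R[i]),
         [/\ approximable T, pi_mem (max_hull k A) E1 Q & P = Q \o T]];
     pi_norm := fun E P => inf [set r |
       exists (E1 : completeNormedModType R[i]) (T : {linear E -> E1}) (Q : E1 -> R[i]),
         [/\ approximable T, pi_mem (max_hull k A) E1 Q, P = Q \o T &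
             r = pi_norm (max_hull k A) E1 Q * opnorm T ^+ k]] |}.

(* Main.v *)
From Pilot Require Import Defs.
From HB Require Import structures.
From mathcomp Require Import all_boot all_order all_algebra.
From mathcomp Require Import perm complex.
From mathcomp Require Import all_classical all_reals.
From mathcomp Require Import ereal topology normedtype sequences.
From mathcomp Require Import ring lra.

(** Both hulls are governed by a description of their norm that turns every
    estimate into one already known for the given sequence.

    For the maximal hull, the norm of P is the supremum of the norms of its
    restrictions to finite dimensional subspaces N, so membership and norm
    bounds are checked on each N separately ([max_restrict], [max_norm_le]).
    Products and multiplication by functionals commute with restriction. For
    the polynomial P_a the point a may lie outside N, so the bound is taken on
    the span of N and a, and then restricted to N; that P_a commutes with
    restriction follows from the polarization formula, which expresses the
    polar form by values of P. Completeness comes from the bound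
    |P x| <= ||P|| |x|^k, valid in every ideal because P composed with z |-> zx
    is P(x) z^k: norm limits on the subspaces N are pointwise limits, so they
    glue to one polynomial on E.

    The minimal hull is the composition of the maximal hull with approximable
    operators, and only the multiplicativity of the latter sequence matters
    ([comp_multiplicative]). By homogeneity the operator of a factorization can
    be rescaled into the unit ball, so ||P|| < r exactly when P = Q o t with t
    an approximable contraction and ||Q|| < r ([comp_factor],
    [comp_ball_le]). Several such contractions are merged into a single one with
    values in an l_infinity sum of their targets, with contractive projections
    giving them back ([approx_join]). Two of them give sums, products, and
    products with functionals with the right constants; a sequence of them,
    damped by the factors 2^-j so that the joint operator stays approximable,
    gives completeness. *)

Set Implicit Arguments.
Unset Strict Implicit.
Unset Printing Implicit Defensive.

Import Order.TTheory GRing.Theory Num.Theory.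
Import numFieldTopology.Exports numFieldNormedType.Exports.
Import Pilot.Defs.

Local Open Scope classical_set_scope.
Local Open Scope ring_scope.
Local Open Scope complex_scope.

(** * Real-valued norms and bounded operators *)
Section RNorm.
Variables (R : realType) (E : normedModType R[i]).
Implicit Types x y : E.

Lemma rnormE x : `|x| = (rnorm x)%:C.
Proof.
have := normr_ge0 x; rewrite lecE /= /rnorm => /andP[/eqP + _].
by case: (`|x|) => a b /= ->.
Qed.

Lemma rnorm_ge0 x : 0 <= rnorm x.
Proof. by have := normr_ge0 x; rewrite rnormE lecR. Qed.

Lemma rnormD x y : rnorm (x + y) <= rnorm x + rnorm y.
Proof. by rewrite -lecR rmorphD /= -!rnormE ler_normD. Qed.

Lemma rnormZ (c : R[i]) x : rnorm (c *: x) = rnorm c * rnorm x.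
Proof.
by apply: (@complexI R); rewrite rmorphM -rnormE normrZ rnormE.
Qed.

Lemma rnorm0 : rnorm (0 : E) = 0.
Proof. by rewrite /rnorm normr0. Qed.

Lemma rnormN x : rnorm (- x) = rnorm x.
Proof. by rewrite /rnorm normrN. Qed.

Lemma rnorm_sub x y : rnorm (x - y) = rnorm (y - x).
Proof. by rewrite -rnormN opprB. Qed.

Lemma rnorm_le0 x : rnorm x <= 0 -> x = 0.
Proof.
move=> x0; apply: normr0_eq0; rewrite rnormE.
by have -> : rnorm x = 0 by apply/eqP; rewrite eq_le x0 rnorm_ge0.
Qed.

End RNorm.

Lemma rnorm_real (R : realType) (r : R) : 0 <= r -> rnorm (r%:C : R[i]) = r.
Proof. by move=> r0; apply: (@complexI R); rewrite -rnormE ger0_norm ?lecR. Qed.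

Lemma rnormM (R : realType) (a b : R[i]) : rnorm (a * b) = rnorm a * rnorm b.
Proof. exact: rnormZ. Qed.

Lemma rnorm1 (R : realType) : rnorm (1 : R[i]) = 1.
Proof. by rewrite /rnorm normr1. Qed.

Lemma rnormX (R : realType) (a : R[i]) n : rnorm (a ^+ n) = rnorm a ^+ n.
Proof. by elim: n => [|n IH]; rewrite ?rnorm1 // !exprS rnormM IH. Qed.

Lemma gt0_complexE (R : realType) (e : R[i]) :
  0 < e -> e = (complex.Re e)%:C /\ 0 < complex.Re e.
Proof. by case: e => p q; rewrite ltcE /= => /andP[/eqP -> ->]. Qed.

Lemma cvg_rnormP (R : realType) (E : normedModType R[i]) (T : Type)
    (F : set_system T) (FF : Filter F) (f : T -> E) (l : E) :
  f @ F --> l <-> forall e : R, 0 < e -> \forall t \near F, rnorm (l - f t) < e.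
Proof.
split=> [/cvgrPdist_lt H e e0|H].
  have ec0 : (0 : R[i]) < e%:C by rewrite ltcR.
  by apply: filterS (H _ ec0) => t; rewrite rnormE ltcR.
apply/cvgrPdist_lt => e /gt0_complexE[-> e0].
by apply: filterS (H _ e0) => t; rewrite rnormE ltcR.
Qed.

Lemma ball_rnormE (R : realType) (E : normedModType R[i]) (x y : E) (e : R) :
  ball x e%:C y = (rnorm (x - y) < e) :> Prop.
Proof. by rewrite -ball_normE /ball_ /= rnormE ltcR. Qed.

Section OpNorm.
Variables (R : realType) (E F : normedModType R[i]).
Implicit Types T S : {linear E -> F}.

Lemma lin_continuous T (M : R) :
  (forall x, rnorm (T x) <= M * rnorm x) -> continuous T.
Proof.
move=> TM; apply: (bounded_linear_continuous (f := T)).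
apply/linear_boundedP; near=> r => x.
rewrite !rnormE.
have r0 : `|M|%:C <= r by near: r; apply: nbhs_pinfty_ge; rewrite complex_real.
have /le_trans : (rnorm (T x))%:C <= `|M|%:C * (rnorm x)%:C.
  rewrite -rmorphM lecR (le_trans (TM x)) // ler_wpM2r ?rnorm_ge0 //.
  exact: ler_norm.
by apply; rewrite ler_wpM2r // lecR rnorm_ge0.
Unshelve. all: by end_near. Qed.

Lemma contraction_continuous T : (forall x, rnorm (T x) <= rnorm x) -> continuous T.
Proof. by move=> T1; apply: (@lin_continuous T 1) => x; rewrite mul1r. Qed.

Lemma lin_bounded T : continuous T ->
  exists2 M : R, 0 <= M & forall x, rnorm (T x) <= M * rnorm x.
Proof.
move=> /(_ 0) /continuous_linear_bounded /linear_boundedP [r [rr rP]].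
pose M : R[i] := (`|complex.Re r| + 1)%:C.
have rM : r < M.
  rewrite /M -(RRe_real rr) /= ltcR.
  by rewrite (le_lt_trans (ler_norm _)) // ltrDl.
exists (`|complex.Re r| + 1); first by rewrite addr_ge0.
by move=> x; have := rP _ rM x; rewrite !rnormE -rmorphM lecR.
Qed.

Lemma opnorm_has_sup (T : E -> F) (M : R) : 0 <= M ->
  (forall x, rnorm (T x) <= M * rnorm x) ->
  has_sup [set rnorm (T x) | x in [set x | rnorm x <= 1]].
Proof.
move=> M0 TM; split.
  by exists (rnorm (T 0)), 0 => //=; rewrite rnorm0.
exists M => _ [x /= x1 <-]; rewrite (le_trans (TM x)) // ler_piMr //.
Qed.

Lemma opnorm_le (T : E -> F) (M : R) : 0 <= M ->
  (forall x, rnorm (T x) <= M * rnorm x) -> opnorm T <= M.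
Proof.
move=> M0 TM; have [ne _] := opnorm_has_sup M0 TM.
apply: ge_sup => // _ [x /= x1 <-]; rewrite (le_trans (TM x)) // ler_piMr //.
Qed.

Lemma opnorm_ge0 T : continuous T -> 0 <= opnorm T.
Proof.
move=> /lin_bounded[M M0 TM]; apply: (ub_le_sup (opnorm_has_sup M0 TM).2).
by exists 0; rewrite /= ?linear0 rnorm0.
Qed.

Lemma le_opnorm T x : continuous T -> rnorm (T x) <= opnorm T * rnorm x.
Proof.
move=> Tc; have [M M0 TM] := lin_bounded Tc.
have [x0|x0] := leP (rnorm x) 0.
  by rewrite (rnorm_le0 x0) linear0 !rnorm0 mulr0.
rewrite -ler_pdivrMr // mulrC.
have -> : (rnorm x)^-1 * rnorm (T x) = rnorm (T ((rnorm x)^-1%:C *: x)).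
  by rewrite linearZ /= rnormZ rnorm_real // invr_ge0 ltW.
apply: (ub_le_sup (opnorm_has_sup M0 TM).2).
exists ((rnorm x)^-1%:C *: x) => //=.
by rewrite rnormZ rnorm_real ?invr_ge0 ?(ltW x0) // mulVf // gt_eqF.
Qed.

End OpNorm.

(** * Polarization *)
Section Multilinear.
Variables (R : realType) (E : normedModType R[i]) (k : nat).
Implicit Types (L : ('I_k -> E) -> R[i]) (P : E -> R[i]) (x y : 'I_k -> E).

Definition slot L x (i : 'I_k) (v : E) : R[i] := L [eta x with i |-> v].

Lemma klinear_slot_sum L (hL : klinear L) x (i : 'I_k) (J : finType)
    (c : J -> R[i]) (u : J -> E) :
  slot L x i (\sum_j c j *: u j) = \sum_j c j * slot L x i (u j).
Proof.
pose g : {linear E -> R[i]} := HB.pack (slot L x i)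
  (GRing.isLinear.Build _ _ _ _ (slot L x i) (hL x i)).
rewrite -[slot L x i]/(g : E -> R[i]) linear_sum.
by apply: eq_bigr => j _; rewrite linearZ.
Qed.

(** The coordinates are expanded one after the other: [r] lists those already
    expanded, and the value [j0] off [r] makes each partial choice of indices
    correspond to exactly one finite function. *)
Lemma klinear_expand_in L (hL : klinear L) (J : finType) (j0 : J)
    (c : J -> R[i]) (u : J -> E) (r : seq 'I_k) y : uniq r ->
  L (fun i => if i \in r then \sum_j c j *: u j else y i) =
  \sum_(f : {ffun 'I_k -> J} | [forall i, (i \notin r) ==> (f i == j0)])
     (\prod_(i <- r) c (f i)) * L (fun i => if i \in r then u (f i) else y i).
Proof.
elim: r y => [|a r IH] y /=.
  rewrite (big_pred1 [ffun=> j0]) ?big_nil ?mul1r // => f /=.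
  apply/forallP/eqP => [fj|-> i]; last by rewrite ffunE.
  by apply/ffunP => i; rewrite ffunE; exact/eqP/fj.
case/andP => ar ur.
pose z i := if i \in r then \sum_j c j *: u j else y i.
have -> : (fun i => if i \in a :: r then \sum_j c j *: u j else y i) =
    [eta z with a |-> \sum_j c j *: u j].
  by apply: funext => i /=; rewrite in_cons /z; case: (i == a).
rewrite -/(slot L z a _) klinear_slot_sum //.
rewrite [RHS](partition_big (fun f : {ffun 'I_k -> J} => f a) predT) //=.
apply: eq_bigr => j _.
have -> : slot L z a (u j) =
    L (fun i => if i \in r then \sum_j c j *: u j else [eta y with a |-> u j] i).
  congr L; apply: funext => i /=; rewrite /z.
  by case: eqP => [->|_]; rewrite ?(negPf ar).
rewrite IH // mulr_sumr.
rewrite [RHS](reindex_onto (fun f : {ffun 'I_k -> J} => [ffun i => if i == a then j else f i])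
  (fun f : {ffun 'I_k -> J} => [ffun i => if i == a then j0 else f i])) /=; last first.
  move=> f /andP[_ /eqP fa]; apply/ffunP => i; rewrite !ffunE.
  by case: eqP => // ->.
apply: eq_big => [f|f _].
  rewrite ffunE eqxx eqxx andbT.
  apply/forallP/andP => [fj|[/forallP fj /eqP fE] i].
    split.
      apply/forallP => i; apply/implyP; rewrite in_cons negb_or => /andP[ia ir].
      by rewrite ffunE (negPf ia); exact: (implyP (fj i)).
    apply/eqP/ffunP => i; rewrite !ffunE; case: eqP => // ->.
    by rewrite (eqP (implyP (fj a) ar)).
  apply/implyP => ir; have [->|ia] := eqVneq i a.
    by rewrite -fE ffunE eqxx.
  have := implyP (fj i); rewrite in_cons (negPf ia) ffunE (negPf ia).
  exact.
rewrite big_cons ffunE eqxx mulrA; congr (_ * _ * _).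
  rewrite big_seq [RHS]big_seq; apply: eq_bigr => i ir; rewrite ffunE.
  by case: eqP => // ia; rewrite -ia ir in ar.
congr L; apply: funext => i /=; rewrite in_cons ffunE.
by case: eqP => [->|_] /=; rewrite ?(negPf ar).
Qed.

Lemma klinear_expand L (hL : klinear L) (J : finType) (c : J -> R[i]) (u : J -> E) :
  J ->
  L (fun=> \sum_j c j *: u j) =
  \sum_(f : {ffun 'I_k -> J}) (\prod_i c (f i)) * L (fun i => u (f i)).
Proof.
move=> j0; have := klinear_expand_in hL j0 c u (fun=> 0) (enum_uniq 'I_k).
have mk i : i \in enum 'I_k by rewrite mem_enum.
set x := (fun i => if _ then _ else _); have -> : x = fun=> \sum_j c j *: u j.
  by apply: funext => i; rewrite /x mk.
move=> ->; apply: eq_big => [f|f _].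
  by apply/forallP => i; rewrite mk.
congr (_ * _); first by rewrite big_enum.
by congr L; apply: funext => i; rewrite mk.
Qed.

(** The inclusion-exclusion form of the polarization formula, with 0/1 sums
    instead of signs; it involves P alone, which gives the uniqueness of the
    polar form and makes it inherit continuity and pointwise limits from P. *)
Definition polarization P x : R[i] :=
  (k`!%:R)^-1 * \sum_(A : {set 'I_k}) (-1) ^+ #|~: A| * P (\sum_(i in A) x i).

(** Expanding the product of the factors 1 + G i, where G i is 0 on B and -1 off
    B, yields this sum, and any i off B makes the product vanish. *)
Lemma sum_sign_supset (B : {pred 'I_k}) :
  \sum_(A : {set 'I_k} | B \subset A) (-1) ^+ #|~: A| =
    [forall i, i \in B]%:R :> R[i].
Proof.
pose G i : R[i] := if i \in B then 0 else -1.
transitivity (\prod_i (1 + G i)); last first.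
  have [/forallP BT|] := boolP [forall i, i \in B].
    by rewrite big1 // => i _; rewrite /G BT addr0.
  rewrite negb_forall => /existsP[i iB].
  by rewrite (bigD1 i) //= /G (negPf iB) subrr mul0r.
rewrite bigA_distr [LHS]big_mkcond /=; apply: eq_bigr => A _.
case: ifPn => [BA|/subsetPn[i iB iA]]; last first.
  by rewrite (bigD1 i) //= (negPf iA) /G iB mul0r.
rewrite -prodr_const big_mkcond /=; apply: eq_bigr => i _.
rewrite finset.inE /G; case: (boolP (i \in A)) => //= iA; case: ifP => // iB.
by rewrite (fintype.subsetP BA i iB) in iA.
Qed.

(** Expanding P (\sum_(i in A) x i) produces the terms L (x o f) for all maps f
    with values in A; after the signed summation over A only the surjective f
    survive, and these are the k! permutations, which leave L unchanged. *)
Lemma polarE P L x : (0 < k)%N -> is_polar P L -> L x = polarization P x.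
Proof.
move=> k_gt0 [hL sL dL]; rewrite /polarization.
have kf : (k`!%:R : R[i]) != 0 by rewrite pnatr_eq0 -lt0n fact_gt0.
apply: (mulfI kf); rewrite mulrA divff // mul1r.
have PE (A : {set 'I_k}) : P (\sum_(i in A) x i) =
    \sum_(f : {ffun 'I_k -> 'I_k} | codom f \subset A) L (x \o f).
  have -> : \sum_(i in A) x i = \sum_i ((i \in A)%:R : R[i]) *: x i.
    by rewrite big_mkcond; apply: eq_bigr => i _; case: (i \in A); rewrite ?scale1r ?scale0r.
  rewrite -dL (klinear_expand hL _ _ (Ordinal k_gt0)) [RHS]big_mkcond /=.
  apply: eq_bigr => f _; case: ifPn => [/fintype.subsetP fA|/subsetPn[_ /codomP[i ->] fA]].
    by rewrite big1 ?mul1r // => i _; rewrite fA // codom_f.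
  by rewrite (bigD1 i) //= (negPf fA) !mul0r.
transitivity (\sum_(s : 'S_k) L x).
  by rewrite sumr_const card_Sn mulr_natl.
transitivity (\sum_(f : {ffun 'I_k -> 'I_k})
    [forall i, i \in codom f]%:R * L (x \o f)).
  transitivity (\sum_(f : {ffun 'I_k -> 'I_k} | injectiveb f) L (x \o f)).
    rewrite (reindex_onto (@pval _) (insubd (1%g : 'S_k))) /=; last first.
      by move=> f fi; rewrite insubdK.
    apply: eq_big => [s|s _]; first by rewrite (valP s) /= valKd eqxx.
    by rewrite -(sL x s); congr L; apply: funext => i /=; rewrite pvalE.
  rewrite big_mkcond /=; apply: eq_bigr => f _.
  have -> : [forall i, i \in codom f] = injectiveb f.
    apply/forallP/injectiveP => [fT|fi i]; last exact: injF_onto.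
    have /image_injP fi : #|codom f| == #|'I_k|.
      by apply/eqP/eq_card => i; rewrite fT.
    by move=> i j; exact: fi.
  by case: (injectiveb f); rewrite ?mul1r ?mul0r.
under eq_bigr do rewrite -sum_sign_supset mulr_suml.
under [RHS]eq_bigr do rewrite PE mulr_sumr.
by rewrite (exchange_big_dep predT).
Qed.
End Multilinear.

(** * Homogeneous polynomials *)
Lemma complex_scaleE (R : realType) (c z : R[i]) : c *: z = c * z.
Proof. by []. Qed.

Section KLinear.
Variables (R : realType) (k : nat).

Lemma klinear_sum_maps (E : normedModType R[i]) (I : Type) (r : seq I)
    (L : I -> ('I_k -> E) -> R[i]) :
  (forall j, klinear (L j)) -> klinear (fun x => \sum_(j <- r) L j x).
Proof.
move=> hL x i c u v /=; rewrite scaler_sumr -big_split; apply: eq_bigr => j _.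
exact: hL.
Qed.

Lemma klinear_scale (E : normedModType R[i]) (a : R[i]) (L : ('I_k -> E) -> R[i]) :
  klinear L -> klinear (fun x => a * L x).
Proof.
by move=> hL x i c u v /=; rewrite hL mulrDr !complex_scaleE mulrCA.
Qed.

Lemma klinear_perm (E : normedModType R[i]) (s : 'S_k) (L : ('I_k -> E) -> R[i]) :
  klinear L -> klinear (fun x => L (x \o s)).
Proof.
move=> hL x i c u v /=.
have sE w : [eta x with i |-> w] \o s = [eta (x \o s) with (s^-1)%g i |-> w].
  by apply: funext => j /=; rewrite (canF_eq (permK s)).
by rewrite !sE; exact: hL.
Qed.

Lemma klinear_comp (E F : normedModType R[i]) (T : {linear E -> F})
    (L : ('I_k -> F) -> R[i]) :
  klinear L -> klinear (fun x => L (T \o x)).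
Proof.
move=> hL x i c u v /=.
have TE w : T \o [eta x with i |-> w] = [eta (T \o x) with i |-> T w].
  by apply: funext => j /=; case: eqP.
by rewrite !TE linearP; exact: hL.
Qed.

End KLinear.

Section Polar.
Variables (R : realType) (E : normedModType R[i]) (k : nat).
Implicit Types (P : E -> R[i]).

Lemma hpoly_has_polar P : hpoly k P -> exists L, @is_polar R E k P L.
Proof.
move=> [_ [L [hL dL]]].
have kf : (k`!%:R : R[i]) != 0 by rewrite pnatr_eq0 -lt0n fact_gt0.
exists (fun x => (k`!%:R)^-1 * \sum_(s : 'S_k) L (x \o s)); split.
- by apply/klinear_scale/klinear_sum_maps => s; exact: klinear_perm.
- move=> x s; congr (_ * _).
  rewrite [RHS](reindex_inj (mulIg s)) /=; apply: eq_bigr => t _.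
  by congr L; apply: funext => i /=; rewrite permM.
- move=> x; rewrite (eq_bigr (fun=> P x)) => [|s _]; last by rewrite -dL.
  by rewrite sumr_const card_Sn -[P x *+ _]mulr_natl mulKf.
Qed.

Lemma polarP P : hpoly k P -> is_polar P (@polar R E k P).
Proof. by move=> /hpoly_has_polar[L LP]; rewrite /polar; case: xgetP => // /(_ L). Qed.

Lemma polar_polarization P x : (0 < k)%N -> hpoly k P ->
  @polar R E k P x = polarization P x.
Proof. by move=> k0 /polarP; exact: polarE. Qed.

Lemma hpoly_homog P (c : R[i]) x : hpoly k P -> P (c *: x) = c ^+ k * P x.
Proof.
move=> [_ [L [hL dL]]].
have := klinear_expand hL (fun _ : 'I_1 => c) (fun=> x) ord0.
rewrite big_ord1 -!dL => ->.
rewrite (big_pred1 [ffun=> ord0]) => [|f].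
  by rewrite prodr_const card_ord.
by apply/esym/eqP/ffunP => i; rewrite [f i]ord1 [RHS]ord1.
Qed.

Lemma hpoly_at0 P : (0 < k)%N -> hpoly k P -> P 0 = 0.
Proof.
by move=> k0 hP; rewrite -[0 in LHS](scale0r 0) hpoly_homog // expr0n gtn_eqF // mul0r.
Qed.

Lemma hpoly_continuous P : hpoly k P -> continuous P.
Proof. by case. Qed.

Lemma hpoly0 : hpoly k (0 : E -> R[i]).
Proof.
split; first exact: cst_continuous.
by exists (fun=> 0); split=> // x i c u v; rewrite scaler0 addr0.
Qed.

Lemma hpolyD P Q : hpoly k P -> hpoly k Q -> hpoly k (P + Q).
Proof.
move=> [cP [L [hL dL]]] [cQ [L' [hL' dL']]]; split.
  by move=> x; apply: continuousD; [exact: cP|exact: cQ].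
exists (fun x => L x + L' x); split=> [x i c u v|x]; last by rewrite /= -dL -dL'.
by rewrite hL hL' scalerDr addrACA.
Qed.

Lemma hpolyZ (a : R[i]) P : hpoly k P -> hpoly k (a *: P).
Proof.
move=> [cP [L [hL dL]]]; split.
  by move=> x; apply: continuousZl_tmp; exact: cP.
by exists (fun x => a * L x); split=> [|x]; [exact: klinear_scale|rewrite -dL].
Qed.

(** A multilinear form representing the limit has to be exhibited; the polar
    forms of the u n converge pointwise, since the polarization formula is a
    finite combination of values. *)
Lemma hpoly_lim (u : nat -> E -> R[i]) P : (0 < k)%N ->
  (forall n, hpoly k (u n)) -> (forall x, u n x @[n --> \oo] --> P x) ->
  continuous P -> hpoly k P.
Proof.
move=> k0 hu uP cP; split=> //.
have up x : polarization (u n) x @[n --> \oo] --> @polarization R E k P x.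
  apply: cvgMl_tmp; apply: (cvg_big add_continuous) => A _; apply: cvgMl_tmp; exact: uP.
have uE n y : polarization (u n) y = @polar R E k (u n) y.
  by rewrite polar_polarization.
exists (polarization P); split=> [x i c v w|x].
  have lin : (fun n => polarization (u n) [eta x with i |-> c *: v + w]) =
      (fun n => c * polarization (u n) [eta x with i |-> v] +
                polarization (u n) [eta x with i |-> w]).
    by apply: funext => n; rewrite !uE; have [h _ _] := polarP (hu n); exact: h.
  have := up [eta x with i |-> c *: v + w]; rewrite lin => h.
  apply: cvg_unique h _ => //.
  by apply: cvgD; [apply: cvgMl_tmp|]; exact: up.
have diag : (fun n => u n x) = (fun n => @polarization R E k (u n) (fun=> x)).
  by rewrite funeqE => n; rewrite uE; have [_ _ h] := polarP (hu n); rewrite h.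
have := uP x; rewrite diag => h.
by apply: cvg_unique h _ => //; exact: up.
Qed.

End Polar.

Section PolyOps.
Variables (R : realType).

Lemma hpoly_comp (E F : normedModType R[i]) k (T : {linear E -> F}) (P : F -> R[i]) :
  continuous T -> hpoly k P -> hpoly k (P \o T).
Proof.
move=> cT [cP [L [hL dL]]]; split.
  by move=> x; apply: continuous_comp; [exact: cT|exact: cP].
by exists (fun x => L (T \o x)); split=> [|x /=]; [exact: klinear_comp|rewrite dL].
Qed.

Lemma hpolyM (E : normedModType R[i]) k l (P Q : E -> R[i]) :
  hpoly k P -> hpoly l Q -> hpoly (k + l) (fun x => P x * Q x).
Proof.
move=> [cP [L [hL dL]]] [cQ [L' [hL' dL']]]; split.
  by move=> x; apply: continuousM; [exact: cP|exact: cQ].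
exists (fun x => L (x \o @lshift k l) * L' (x \o @rshift k l)); split=> [x i c u v|x /=].
  case: (split_ordP i) => j -> {i} /=.
  - have lE w : [eta x with lshift l j |-> w] \o @lshift k l =
        [eta (x \o @lshift k l) with j |-> w].
      by apply: funext => m /=; rewrite (inj_eq (@lshift_inj _ _)).
    have rE w : [eta x with lshift l j |-> w] \o @rshift k l = x \o @rshift k l.
      by apply: funext => m /=; rewrite eq_rlshift.
    by rewrite !lE !rE hL mulrDl !complex_scaleE mulrA.
  - have lE w : [eta x with rshift k j |-> w] \o @lshift k l = x \o @lshift k l.
      by apply: funext => m /=; rewrite eq_lrshift.
    have rE w : [eta x with rshift k j |-> w] \o @rshift k l =
        [eta (x \o @rshift k l) with j |-> w].
      by apply: funext => m /=; rewrite (inj_eq (@rshift_inj _ _)).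
    by rewrite !lE !rE hL' mulrDr !complex_scaleE mulrCA.
by rewrite dL dL'.
Qed.

Lemma hpoly_linear (E : normedModType R[i]) (g : {linear E -> R[i]}) :
  continuous g -> hpoly 1 g.
Proof.
move=> cg; split=> //; exists (fun x => g (x ord0)); split=> // x i c u v.
by rewrite /= (ord1 i) /= linearP.
Qed.

Lemma hpoly_exp k : hpoly k (fun z : R[i] => z ^+ k).
Proof.
elim: k => [|k IH].
  split; first exact: cst_continuous.
  by exists (fun=> 1); split=> // x [].
have -> : (fun z : R[i] => z ^+ k.+1) = (fun z => z * z ^+ k).
  by apply: funext => z; rewrite exprS.
rewrite -add1n; apply: hpolyM => //.
by apply: (hpoly_linear (g := idfun)) => x; exact: cvg_id.
Qed.

Lemma hpoly_poly_at (E : normedModType R[i]) k (P : E -> R[i]) (a : E) :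
  hpoly k.+1 P -> hpoly k (poly_at k P a).
Proof.
move=> hP; have [hL _ dL] := polarP hP; split.
  have -> : poly_at k P a = fun x => @polarization R E k.+1 P [eta (fun=> x) with ord0 |-> a].
    by apply: funext => x; rewrite /poly_at polar_polarization.
  move=> x; apply: cvgMl_tmp; apply: (cvg_big add_continuous) => A _; apply: cvgMl_tmp.
  apply: continuous_cvg; first exact: (hpoly_continuous hP).
  apply: (cvg_big add_continuous) => i _ /=; case: eqP => _; [exact: cvg_cst|exact: cvg_id].
exists (fun x : 'I_k -> E => @polar R E k.+1 P (fun i => oapp x a (unlift ord0 i))).
split=> [x i c u v|x].
  have sE w : (fun j : 'I_k.+1 => oapp [eta x with i |-> w] a (unlift ord0 j)) =
      [eta (fun j => oapp x a (unlift ord0 j)) with lift ord0 i |-> w].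
    apply: funext => j /=; case: unliftP => [m ->|->] /=.
      by rewrite (inj_eq lift_inj).
    by [].
  by rewrite !sE hL.
congr (polar _ _); apply: funext => j /=.
by case: unliftP => [m ->|->] //=; rewrite eq_sym (negPf (neq_lift _ _)).
Qed.

(** Uniqueness of the polar form, read off from the polarization formula, gives
    this compatibility, which the default value in the definition of [polar]
    would otherwise obscure. *)
Lemma poly_at_comp (E F : normedModType R[i]) k (T : {linear E -> F})
    (P : F -> R[i]) (a : E) : continuous T -> hpoly k.+1 P ->
  poly_at k (P \o T) a = poly_at k P (T a) \o T.
Proof.
move=> cT hP; apply: funext => x /=; rewrite /poly_at.
rewrite !polar_polarization //; last exact: hpoly_comp.
congr (_ * _); apply: eq_bigr => A _; congr (_ * P _).
by rewrite linear_sum; apply: eq_bigr => i _ /=; case: eqP.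
Qed.

End PolyOps.

(** * Banach ideals of polynomials *)
Section Ray.
Variables (R : realType) (E : normedModType R[i]) (x : E).

Definition ray (z : R[i]) : E := z *: x.

Lemma ray_is_linear : linear ray.
Proof. by move=> c u v; rewrite /ray scalerDl scalerA. Qed.

HB.instance Definition _ := GRing.isLinear.Build R[i] R[i] E *:%R ray ray_is_linear.

Lemma rnorm_ray z : rnorm (ray z) <= rnorm x * rnorm z.
Proof. by rewrite rnormZ mulrC. Qed.

End Ray.

(** The approximation is uniform on bounded sets, because of the factor
    rnorm x ^+ k, and continuity at a point concerns only a bounded set. *)
Lemma limit_continuous (R : realType) (E : normedModType R[i]) k
    (u : nat -> E -> R[i]) (P : E -> R[i]) :
  (forall n, continuous (u n)) ->
  (forall e : R, 0 < e -> exists n, forall x, rnorm (u n x - P x) <= e * rnorm x ^+ k) ->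
  continuous P.
Proof.
move=> cu uP x; apply/cvg_rnormP => e e0.
pose r := rnorm x + 1.
have r0 : 0 < r ^+ k by rewrite exprn_gt0 // ltr_wpDl // rnorm_ge0.
have e3 : 0 < e / 4 by rewrite divr_gt0.
have [n un] := uP _ (divr_gt0 e3 r0).
have bnd y : rnorm y <= r -> rnorm (u n y - P y) <= e / 4.
  move=> yr; rewrite (le_trans (un y)) // -mulrA ler_piMr ?(ltW e3) //.
  by rewrite mulrC ler_pdivrMr // mul1r lerXn2r // nnegrE ?rnorm_ge0 // (le_trans (rnorm_ge0 _) yr).
have /cvg_rnormP/(_ _ e3) ux := cu n x.
have /cvg_rnormP/(_ _ (@ltr01 R)) idx : id @ x --> x by exact: cvg_id.
apply: filterS2 ux idx => y uy /= xy.
have yr : rnorm y <= r.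
  have -> : y = x + - (x - y) by rewrite opprB addrC subrK.
  by rewrite (le_trans (rnormD _ _)) // lerD // rnormN ltW.
have xr : rnorm x <= r by rewrite lerDl.
have -> : P x - P y = (u n x - u n y) + ((u n y - P y) - (u n x - P x)).
  by ring.
have := rnormD (u n y - P y) (- (u n x - P x)).
rewrite rnormN => h; have := rnormD (u n x - u n y) ((u n y - P y) - (u n x - P x)).
have := bnd _ xr; have := bnd _ yr; lra.
Qed.

(** The reverse inequality is the given one for the scalar c^-1 and c *: P. *)
Lemma norm_homog_of_le (R : realType) (T : Type) (V : set (T -> R[i]))
    (N : (T -> R[i]) -> R) :
  (forall P, V P -> 0 <= N P) ->
  (forall c P, V P -> V (c *: P) /\ N (c *: P) <= rnorm c * N P) ->
  forall c P, V P -> N (c *: P) = rnorm c * N P.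
Proof.
move=> N0 VZ c P VP; have [VcP le] := VZ c P VP; apply/eqP; rewrite eq_le le /=.
have [c0|c0] := eqVneq c 0; first by rewrite {1}c0 rnorm0 mul0r N0.
have rc : rnorm c * rnorm c^-1 = 1 by rewrite -rnormM divff // rnorm1.
have := (VZ c^-1 _ VcP).2; rewrite scalerA mulVf // scale1r => h.
by rewrite (le_trans (ler_wpM2l (rnorm_ge0 c) h)) // mulrA rc mul1r.
Qed.

Section Ideal.
Variables (R : realType) (k : nat) (A : poly_ideal R).
Hypothesis bA : banach_ideal k A.
Implicit Types E F : completeNormedModType R[i].

Lemma ideal_hpoly E P : pi_mem A E P -> hpoly k P.
Proof. by case: bA => /(_ E)[sub _] _ _; exact: sub. Qed.

Lemma ideal0 E : pi_mem A E 0.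
Proof. by case: bA => /(_ E)[_ [[]]]. Qed.

Lemma idealD E P Q : pi_mem A E P -> pi_mem A E Q -> pi_mem A E (P + Q).
Proof. by case: bA => /(_ E)[_ [[_ h _] _ _] _ _]; exact: h. Qed.

Lemma idealZ E c P : pi_mem A E P -> pi_mem A E (c *: P).
Proof. by case: bA => /(_ E)[_ [[_ _ h] _ _] _ _]; exact: h. Qed.

Lemma idealB E P Q : pi_mem A E P -> pi_mem A E Q -> pi_mem A E (P - Q).
Proof. by move=> hP hQ; rewrite -scaleN1r; apply: idealD => //; exact: idealZ. Qed.

Lemma ideal_norm_ge0 E P : pi_mem A E P -> 0 <= pi_norm A E P.
Proof. by case: bA => /(_ E)[_ [_ [h _ _ _] _] _ _]; exact: h. Qed.

Lemma ideal_normZ E c P : pi_mem A E P -> pi_norm A E (c *: P) = rnorm c * pi_norm A E P.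
Proof. by case: bA => /(_ E)[_ [_ [_ _ h _] _] _ _]; exact: h. Qed.

Lemma ideal_normD E P Q : pi_mem A E P -> pi_mem A E Q ->
  pi_norm A E (P + Q) <= pi_norm A E P + pi_norm A E Q.
Proof. by case: bA => /(_ E)[_ [_ [_ _ _ h] _] _ _]; exact: h. Qed.

Lemma ideal_norm0 E : pi_norm A E 0 = 0.
Proof. by rewrite -[0 in LHS](scale0r (0 : E -> R[i])) ideal_normZ ?rnorm0 ?mul0r //; exact: ideal0. Qed.

Lemma ideal_normB E P Q : pi_mem A E P -> pi_mem A E Q ->
  pi_norm A E (P - Q) <= pi_norm A E P + pi_norm A E Q.
Proof.
move=> hP hQ; rewrite -scaleN1r (le_trans (ideal_normD hP (idealZ _ hQ))) //.
by rewrite ideal_normZ // rnormN rnorm1 mul1r.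
Qed.

Lemma ideal_complete E (u : nat -> E -> R[i]) : (forall n, pi_mem A E (u n)) ->
  (forall e : R, 0 < e -> exists n0 : nat, forall m n : nat,
     (n0 <= m)%N -> (n0 <= n)%N -> pi_norm A E (u m - u n) < e) ->
  exists2 P, pi_mem A E P & pi_norm A E (u n - P) @[n --> \oo] --> (0 : R).
Proof. by case: bA => /(_ E)[_ [_ _ h] _ _]; exact: h. Qed.

Lemma ideal_comp E F (T : {linear E -> F}) P : continuous T -> pi_mem A F P ->
  pi_mem A E (P \o T).
Proof. by case: bA => _ h _ cT hP; case: (h _ _ _ _ cT hP). Qed.

Lemma ideal_comp_le E F (T : {linear E -> F}) P (M : R) : 0 <= M ->
  (forall x, rnorm (T x) <= M * rnorm x) -> pi_mem A F P ->
  pi_norm A E (P \o T) <= pi_norm A F P * M ^+ k.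
Proof.
move=> M0 TM hP; have cT := lin_continuous TM.
case: bA => _ h _; case: (h _ _ _ _ cT hP) => _ /le_trans; apply.
rewrite ler_wpM2l ?ideal_norm_ge0 // lerXn2r ?nnegrE ?opnorm_ge0 //.
exact: opnorm_le.
Qed.

Lemma ideal_comp_le1 E F (T : {linear E -> F}) P :
  (forall x, rnorm (T x) <= rnorm x) -> pi_mem A F P ->
  pi_norm A E (P \o T) <= pi_norm A F P.
Proof.
move=> T1 hP; have := @ideal_comp_le _ _ T P 1 ler01.
rewrite expr1n mulr1; apply=> // x; by rewrite mul1r.
Qed.

(** Along the ray z |-> z *: x the polynomial is P x times z ^ k, and z ^ k has
    norm 1. *)
Lemma ideal_bound E P x : pi_mem A E P ->
  rnorm (P x) <= pi_norm A E P * rnorm x ^+ k.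
Proof.
move=> hP.
have [_ _ [mz nz]] := bA.
have PE : P \o ray x = P x *: (fun z : R[i] => z ^+ k).
  by apply: funext => z /=; rewrite /ray (hpoly_homog _ _ (ideal_hpoly hP)) mulrC.
have := ideal_comp_le (rnorm_ge0 x) (rnorm_ray x) hP.
by rewrite PE ideal_normZ // nz mulr1.
Qed.

Lemma ideal_cvg E (u : nat -> E -> R[i]) P x : (forall n, pi_mem A E (u n)) ->
  pi_mem A E P -> pi_norm A E (u n - P) @[n --> \oo] --> (0 : R) ->
  u n x @[n --> \oo] --> P x.
Proof.
move=> hu hP uP; apply/cvg_rnormP => e e0.
have r0 : 0 < rnorm x ^+ k + 1 by rewrite ltr_wpDl // exprn_ge0 // rnorm_ge0.
move/cvgrPdist_lt: uP => /(_ _ (divr_gt0 e0 r0)); apply: filterS => n.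
rewrite sub0r normrN ger0_norm; last by rewrite ideal_norm_ge0 //; exact: idealB.
rewrite ltr_pdivlMr // => ue; rewrite rnorm_sub (le_lt_trans _ ue) //.
rewrite (le_trans (ideal_bound x (idealB (hu n) hP))) //.
by rewrite ler_wpM2l ?lerDl // ideal_norm_ge0 //; exact: idealB.
Qed.

End Ideal.

(** * Finite dimensional subspaces *)
Section FDS.
Variables (R : realType).
Implicit Types E F : normedModType R[i].

Lemma in_spanZD E (s : seq E) c x y :
  in_span s x -> in_span s y -> in_span s (c *: x + y).
Proof.
move=> sx sy; have [_ h] := in_span_submod s.
by apply/asboolP; apply: (h c x y); exact/asboolP.
Qed.

Lemma in_span0 E (s : seq E) : in_span s 0.
Proof. by have [/asboolP] := in_span_submod s. Qed.

Lemma in_span_sub E (s t : seq E) : {subset s <= t} -> forall x, in_span s x -> in_span t x.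
Proof.
elim: s => [|a s IH] st x; first by case=> c ->; rewrite big_ord0; exact: in_span0.
case/in_span_cons => c /IH sx; rewrite -[x](subrK (c *: a)) addrC.
have ta : in_span t a.
  have : a \in t by apply: st; rewrite mem_head.
  elim: t {st sx IH} => // b t IH; rewrite in_cons => /orP[/eqP->|/IH ta].
    by apply/in_span_cons; exists 1; rewrite scale1r subrr; exact: in_span0.
  by apply/in_span_cons; exists 0; rewrite scale0r subr0.
apply: in_spanZD => //; apply: sx => y ys; apply: st.
by rewrite in_cons ys orbT.
Qed.

Lemma in_span_mem E (s : seq E) x : x \in s -> in_span s x.
Proof.
move=> xs; apply: (@in_span_sub _ [:: x]).
  by move=> y; rewrite mem_seq1 => /eqP->.
by apply/in_span_cons; exists 1; rewrite scale1r subrr; exact: in_span0.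
Qed.

Lemma in_span_map E F (T : {linear E -> F}) (s : seq E) x :
  in_span s x -> in_span (map T s) (T x).
Proof.
move=> [c ->]; rewrite linear_sum; exists c; rewrite size_map.
by apply: eq_bigr => i _; rewrite linearZ (nth_map 0).
Qed.

Lemma span_fds_subproof E (s : seq E) :
  exists t : seq E, forall x, (x \in [pred x | `[< in_span s x >]]) <-> in_span t x.
Proof. by exists s => x; split=> [/asboolP|h] //; exact/asboolP. Qed.

Definition span_fds E (s : seq E) : fdsubspace E := FDSubspace (span_fds_subproof s).

Lemma mem_span_fds E (s : seq E) x : (x \in fds_pred (span_fds s)) <-> in_span s x.
Proof. by split=> [/asboolP|h] //; exact/asboolP. Qed.

Lemma mem_span_fds_in E (s : seq E) x : x \in s -> x \in fds_pred (span_fds s).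
Proof. by move=> xs; apply/mem_span_fds/in_span_mem. Qed.

Lemma fds_valP E (N : fdsubspace E) (x : fds_type N) : val x \in fds_pred N.
Proof. exact: valP. Qed.

Section FdsMap.
Variables (E F : normedModType R[i]) (T : {linear E -> F}).
Variables (N : fdsubspace E) (M : fdsubspace F).
Hypothesis TNM : forall x, x \in fds_pred N -> T x \in fds_pred M.

(** The operator T between subspaces: inclusions are the case of the identity,
    and restrictions of T have as target the span of the image. *)
Definition fds_map (x : fds_type N) : fds_type M := FDSElt (TNM (fds_valP x)).

Lemma fds_map_linear : linear fds_map.
Proof. by move=> c x y; apply: val_inj; rewrite /= !linearP. Qed.

HB.instance Definition _ :=
  GRing.isLinear.Build R[i] (fds_type N) (fds_type M) *:%R fds_map fds_map_linear.

End FdsMap.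

Lemma rnorm_val E (N : fdsubspace E) (x : fds_type N) : rnorm (val x) = rnorm x.
Proof. by rewrite /rnorm fds_normE. Qed.

End FDS.

(** * The maximal hull of a Banach ideal *)
Section MaxHull.
Variables (R : realType) (k : nat) (A : poly_ideal R).
Hypotheses (k0 : (0 < k)%N) (bA : banach_ideal k A).
Implicit Types E F : completeNormedModType R[i].

Local Notation Amax := (max_hull k A).

Lemma max_restrict E P (N : fdsubspace E) : pi_mem Amax E P ->
  pi_mem A (fds_type N) (P \o val) /\
  pi_norm A (fds_type N) (P \o val) <= pi_norm Amax E P.
Proof.
move=> [hP fP].
have h : (pi_enorm A (P \o (val : fds_type N -> E)) <= max_enorm A P)%E.
  by apply: ereal_sup_ubound; exists N.
have := le_lt_trans h fP; rewrite /pi_enorm; case: asboolP => // mP _; split=> //.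
move: h; rewrite /pi_enorm asboolT //= => h.
rewrite -lee_fin fineK //; rewrite ge0_fin_numE // (le_trans _ h) //.
by rewrite lee_fin (ideal_norm_ge0 bA).
Qed.

Lemma max_norm_le E P (r : R) : hpoly k P ->
  (forall N : fdsubspace E, pi_mem A (fds_type N) (P \o val) /\
     pi_norm A (fds_type N) (P \o val) <= r) ->
  pi_mem Amax E P /\ pi_norm Amax E P <= r.
Proof.
move=> hP PN.
have le : (max_enorm A P <= r%:E)%E.
  apply: ge_ereal_sup => _ [N _ <-]; have [mP Pr] := PN N.
  by rewrite /pi_enorm asboolT // lee_fin.
have mP : pi_mem Amax E P by split=> //; rewrite (le_lt_trans le) ?ltry.
split=> //; have [m h] := PN (span_fds [::]).
have ge : (0 <= max_enorm A P)%E.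
  apply: (@le_trans _ _ (pi_enorm A (P \o (val : fds_type (span_fds [::]) -> E)))).
    by rewrite /pi_enorm asboolT // lee_fin (ideal_norm_ge0 bA).
  by apply: ereal_sup_ubound; exists (span_fds [::]).
rewrite -lee_fin fineK // ge0_fin_numE //; by case: mP.
Qed.

Lemma max_bound E P x : pi_mem Amax E P ->
  rnorm (P x) <= pi_norm Amax E P * rnorm x ^+ k.
Proof.
move=> mP; have xN : x \in fds_pred (span_fds [:: x]).
  by apply: mem_span_fds_in; rewrite mem_head.
have [m le] := max_restrict (span_fds [:: x]) mP.
have := ideal_bound bA (FDSElt xN) m; rewrite /= -rnorm_val /= => /le_trans; apply.
by rewrite ler_wpM2r // exprn_ge0 // rnorm_ge0.
Qed.

Lemma max_norm_ge0 E P : pi_mem Amax E P -> 0 <= pi_norm Amax E P.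
Proof.
move=> mP; have [m le] := max_restrict (span_fds [::]) mP.
exact: le_trans (ideal_norm_ge0 bA m) le.
Qed.

(** The restrictions of u n to each N converge in norm, hence pointwise, so that
    their limits agree on overlaps and define P. The Cauchy estimate is uniform
    in N and passes to the limit, which makes u n converge to P in the norm of
    the hull. *)
Lemma max_complete E (u : nat -> E -> R[i]) : (forall n, pi_mem Amax E (u n)) ->
  (forall e : R, 0 < e -> exists n0 : nat, forall m n : nat,
     (n0 <= m)%N -> (n0 <= n)%N ->
     pi_mem Amax E (u m - u n) /\ pi_norm Amax E (u m - u n) < e) ->
  exists2 P, hpoly k P & forall e : R, 0 < e -> exists n0 : nat, forall n, (n0 <= n)%N ->
    pi_mem Amax E (u n - P) /\ pi_norm Amax E (u n - P) <= e.
Proof.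
move=> mu cu.
have restr (N : fdsubspace E) : exists2 Q : fds_type N -> R[i], pi_mem A (fds_type N) Q &
    pi_norm A (fds_type N) ((u n \o val) - Q) @[n --> \oo] --> (0 : R).
  apply: (ideal_complete bA) => [n|e e0]; first exact: (max_restrict N (mu n)).1.
  have [n0 n0P] := cu _ e0; exists n0 => m n n0m n0n.
  have [mmn lmn] := n0P _ _ n0m n0n.
  exact: le_lt_trans (max_restrict N mmn).2 lmn.
have /boolp.choice[P uP] : forall x : E, exists p : R[i], u n x @[n --> \oo] --> p.
  move=> x; have [Q mQ uQ] := restr (span_fds [:: x]).
  have xN : x \in fds_pred (span_fds [:: x]).
    by apply: mem_span_fds_in; rewrite mem_head.
  exists (Q (FDSElt xN)).
  exact: (ideal_cvg (u := fun n => u n \o (val : fds_type (span_fds [:: x]) -> E)) (x := FDSElt xN) bA (fun n => (max_restrict _ (mu n)).1) mQ uQ).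
have restrP (N : fdsubspace E) : pi_mem A (fds_type N) (P \o val) /\
    pi_norm A (fds_type N) ((u n \o val) - (P \o val)) @[n --> \oo] --> (0 : R).
  have [Q mQ uQ] := restr N; suff -> : P \o val = Q by [].
  apply: funext => y /=; apply: (cvg_unique _ (uP (val y))) => //.
  exact: (ideal_cvg (u := fun n => u n \o (val : fds_type N -> E)) (x := y) bA (fun n => (max_restrict _ (mu n)).1) mQ uQ).
have close (e : R) : 0 < e -> exists n0 : nat, forall n, (n0 <= n)%N ->
    forall N : fdsubspace E, pi_mem A (fds_type N) ((u n - P) \o val) /\
      pi_norm A (fds_type N) ((u n - P) \o val) <= e.
  move=> e0; have [n0 n0P] := cu _ e0; exists n0 => n n0n N.
  have [mP uPN] := restrP N.
  have muN m := (max_restrict N (mu m)).1.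
  split; first exact: (idealB bA (muN n) mP).
  apply/ler_addgt0Pr => e' e'0.
  move/cvgrPdist_lt: uPN => /(_ _ e'0) [m0 _ m0P].
  pose m := maxn n0 m0.
  have [mmn lmn] := n0P _ m n0n (leq_maxl _ _).
  have := m0P m (leq_maxr _ _).
  rewrite /= sub0r normrN ger0_norm; last exact/(ideal_norm_ge0 bA)/(idealB bA).
  move=> mP'.
  have -> : (u n - P) \o val = ((u n - u m) \o val) + ((u m \o val) - (P \o val)) :> (fds_type N -> R[i]).
    by apply: funext => y /=; rewrite !fctE /=; ring.
  have [mN lN] := max_restrict N mmn.
  rewrite (le_trans (ideal_normD bA mN (idealB bA (muN m) mP))) //.
  by rewrite lerD ?(ltW mP') // (le_trans lN) // ltW.
have hP : hpoly k P.
  have hu n : hpoly k (u n) by case: (mu n).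
  apply: (hpoly_lim k0 hu uP).
  apply: (@limit_continuous _ _ k u); first by move=> n; case: (hu n).
  move=> e e0; have [n nP] := close _ e0; exists n => x.
  have xN : x \in fds_pred (span_fds [:: x]).
    by apply: mem_span_fds_in; rewrite mem_head.
  have [m le] := nP n (leqnn _) (span_fds [:: x]).
  have := ideal_bound bA (FDSElt xN) m; rewrite /= -rnorm_val /= => /le_trans; apply.
  by rewrite ler_wpM2r // exprn_ge0 // rnorm_ge0.
exists P => // e e0; have [n0 n0P] := close _ e0; exists n0 => n n0n.
apply: max_norm_le; last exact: n0P.
apply: hpolyD; first by case: (mu n).
by rewrite -scaleN1r; exact: hpolyZ.
Qed.

Lemma max_comp E F (T : {linear E -> F}) P : continuous T -> pi_mem Amax F P ->
  pi_mem Amax E (P \o T) /\ pi_norm Amax E (P \o T) <= pi_norm Amax F P * opnorm T ^+ k.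
Proof.
move=> cT mP; apply: max_norm_le => [|N].
  by apply: hpoly_comp => //; case: mP.
have [s sP] := fds_span N.
have TN x : x \in fds_pred N -> T x \in fds_pred (span_fds (map T s)).
  by move=> /sP sx; apply/mem_span_fds/in_span_map.
have -> : (P \o T) \o val = (P \o val) \o (fds_map TN : {linear _ -> _}) :> (fds_type N -> R[i]).
  by [].
have [m le] := max_restrict (span_fds (map T s)) mP.
have Tb (x : fds_type N) : rnorm (fds_map TN x) <= opnorm T * rnorm x.
  by rewrite -!rnorm_val; exact: le_opnorm.
split.
  by apply: (ideal_comp bA) => //; exact: lin_continuous Tb.
rewrite (le_trans (ideal_comp_le bA _ Tb m)) ?opnorm_ge0 //.
by rewrite ler_wpM2r // exprn_ge0 // opnorm_ge0.
Qed.

Lemma max_banach : banach_ideal k Amax.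
Proof.
have mD E P Q : pi_mem Amax E P -> pi_mem Amax E Q ->
    pi_mem Amax E (P + Q) /\ pi_norm Amax E (P + Q) <= pi_norm Amax E P + pi_norm Amax E Q.
  move=> mP mQ; apply: max_norm_le => [|N].
    by apply: hpolyD; [case: mP|case: mQ].
  have [P1 P2] := max_restrict N mP; have [Q1 Q2] := max_restrict N mQ.
  split; first exact: (idealD bA P1 Q1).
  by rewrite (le_trans (ideal_normD bA P1 Q1)) // lerD.
have mZ E c P : pi_mem Amax E P ->
    pi_mem Amax E (c *: P) /\ pi_norm Amax E (c *: P) <= rnorm c * pi_norm Amax E P.
  move=> mP; apply: max_norm_le => [|N].
    by apply: hpolyZ; case: mP.
  have [P1 P2] := max_restrict N mP.
  split; first exact: (idealZ bA c P1).
  by rewrite [leLHS](ideal_normZ bA c P1) ler_wpM2l // rnorm_ge0.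
split.
- move=> E; split; first by move=> P [].
  split.
  + split; [|by move=> P Q mP mQ; exact: (mD _ _ _ mP mQ).1|
      by move=> c P mP; exact: (mZ _ c _ mP).1].
    apply: (max_norm_le (r := 0) (hpoly0 _ _) _).1 => N.
    by split; [exact: (ideal0 bA)|rewrite (ideal_norm0 bA (fds_type N))].
  + split; [exact: max_norm_ge0| | |by move=> P Q mP mQ; exact: (mD _ _ _ mP mQ).2].
      move=> P mP N0; apply: funext => x; apply: rnorm_le0.
      by have := max_bound x mP; rewrite N0 mul0r.
    by apply: norm_homog_of_le; [exact: max_norm_ge0|exact: mZ].
  + move=> u mu cu.
    have mN1 P : pi_mem Amax E P -> pi_mem Amax E (- P).
      by move=> mP; rewrite -scaleN1r; exact: (mZ _ _ _ mP).1.
    have [|P hP uP] := max_complete mu.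
      move=> e e0; have [n0 n0P] := cu _ e0; exists n0 => m n hm hn; split; last exact: n0P.
      by apply: (mD _ _ _ _ _).1 => //; exact: mN1.
    exists P.
      have [n0 n0P] := uP _ (@ltr01 R).
      have [m _] := n0P _ (leqnn _).
      have -> : P = u n0 - (u n0 - P) by rewrite opprB addrC subrK.
      by apply: (mD _ _ _ _ _).1 => //; exact: mN1.
    apply/cvgrPdist_le => e e0; have [n0 n0P] := uP _ e0.
    exists n0 => // n /= /n0P[m le].
    by rewrite sub0r normrN ger0_norm // max_norm_ge0.
- by move=> E F T P cT mP; exact: max_comp.
- have [_ _ [mz nz]] := bA.
  have [m le] : pi_mem Amax R[i] (fun z => z ^+ k) /\ pi_norm Amax R[i] (fun z => z ^+ k) <= 1.
    apply: max_norm_le => [|N]; first exact: hpoly_exp.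
    pose T : {linear fds_type N -> R[i]} := val.
    have vb x : rnorm (T x) <= rnorm x by rewrite -rnorm_val.
    have cT : continuous T by exact: contraction_continuous.
    split; first exact: (ideal_comp bA cT mz).
    by rewrite -nz; exact: (ideal_comp_le1 bA vb mz).
  split=> //; apply/eqP; rewrite eq_le le /=.
  by have := max_bound (1 : R[i]) m; rewrite expr1n rnorm1 expr1n mulr1.
Qed.

End MaxHull.

(** * Multiplicativity of the maximal hulls *)
Section MaxSequence.
Variables (R : realType) (A : nat -> poly_ideal R).

Local Notation Amax := (fun k => max_hull k (A k)).

Lemma continuous_val (E : normedModType R[i]) (N : fdsubspace E) :
  continuous (val : fds_type N -> E).
Proof.
by apply: contraction_continuous => x; rewrite rnorm_val.
Qed.

Lemma max_coherent : coherent A -> coherent Amax.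
Proof.
move=> [bA [C [D [C0 D0 cA]]]]; split=> [k k0|]; first exact: max_banach (bA k k0).
exists C, D; split; [exact: C0|exact: D0|] => E k k0; have bk := bA k k0; have bk1 := bA k.+1 isT.
split=> [P a mP|P g cg mP].
  have hP : hpoly k.+1 P by case: mP.
  apply: (max_norm_le bk) => [|N]; first exact: hpoly_poly_at.
  have [s sP] := fds_span N.
  (* the polynomial P_a on N is obtained from the larger space N + <a> *)
  pose N' := span_fds (a :: s).
  have aN' : a \in fds_pred N' by apply: mem_span_fds_in; rewrite mem_head.
  have NN' x : x \in fds_pred N -> idfun x \in fds_pred N'.
    move=> /sP sx; apply/mem_span_fds; apply: in_span_sub sx => y ys.
    by rewrite in_cons ys orbT.
  have [m le] := max_restrict bk1 N' mP.
  have [/(_ _ (FDSElt aN') m)[ma lea] _] := cA (fds_type N') k k0.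
  have PE : poly_at k P a \o (val : fds_type N -> E) =
      poly_at k (P \o (val : fds_type N' -> E)) (FDSElt aN') \o
        (fds_map NN' : {linear fds_type N -> fds_type N'}).
    by rewrite (poly_at_comp _ (@continuous_val _ N')).
  have b1 (x : fds_type N) : rnorm (fds_map NN' x) <= rnorm x.
    by rewrite -!rnorm_val.
  rewrite PE; split.
    exact: (ideal_comp bk (contraction_continuous b1) ma).
  rewrite (le_trans (ideal_comp_le1 bk b1 ma)) // (le_trans lea) //.
  by rewrite -rnorm_val /= ler_wpM2r ?rnorm_ge0 // ler_wpM2l // ltW.
have hP : hpoly k P by case: mP.
apply: (max_norm_le bk1) => [|N].
  exact: (hpolyM (hpoly_linear cg) hP).
have [m le] := max_restrict bk N mP.
pose gv : {linear fds_type N -> R[i]} := g \o val.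
have gN x : rnorm (gv x) <= opnorm g * rnorm x.
  by rewrite -rnorm_val; exact: (le_opnorm (val x) cg).
have [_ /(_ _ gv (lin_continuous gN) m)[mg leg]] := cA (fds_type N) k k0.
split=> //; rewrite (le_trans leg) // ler_pM //.
- by rewrite mulr_ge0 ?(ltW D0) // (opnorm_ge0 (lin_continuous gN)).
- exact: (ideal_norm_ge0 bk).
- by rewrite ler_wpM2l ?(ltW D0) //; apply: opnorm_le => //; exact: opnorm_ge0.
Qed.

Lemma max_multiplicative : multiplicative A -> multiplicative Amax.
Proof.
move=> [coA [M mA]]; split; first exact: max_coherent.
(* M may be negative, and then bounds multiplied by its powers do not compare *)
exists `|M| => k l k0 l0 E P Q mP mQ.
have [bA _] := coA; have bk := bA _ k0; have bl := bA _ l0.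
have kl0 : (0 < k + l)%N by rewrite addn_gt0 k0.
apply: (max_norm_le (bA _ kl0)) => [|N].
  by apply: hpolyM; [case: mP|case: mQ].
have [mP' leP] := max_restrict bk N mP; have [mQ' leQ] := max_restrict bl N mQ.
have [m le] := mA _ _ k0 l0 _ _ _ mP' mQ'.
split; first exact: m.
have MM : M ^+ (k + l) <= `|M| ^+ (k + l) by rewrite -normrX ler_norm.
have P0 := ideal_norm_ge0 bk mP'; have Q0 := ideal_norm_ge0 bl mQ'.
apply: (le_trans le); apply: (@le_trans _ _ (`|M| ^+ (k + l) *
    pi_norm (A k) (fds_type N) (P \o val) * pi_norm (A l) (fds_type N) (Q \o val))).
  by rewrite -!mulrA ler_wpM2r ?mulr_ge0.
by rewrite ler_pM ?mulr_ge0 ?exprn_ge0 // ler_wpM2l ?exprn_ge0.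
Qed.

End MaxSequence.

(** * The l_infinity sum of a family of Banach spaces *)
Section LinfSum.
Variables (R : realType) (I : eqType) (E : I -> completeNormedModType R[i]).

Definition bounded_family (x : forall i, E i) : Prop :=
  exists M : R, forall i, rnorm (x i) <= M.

Record linf := Linf {
  linf_fun :> forall i, E i;
  linf_bounded : `[< bounded_family linf_fun >] }.

HB.instance Definition _ := gen_eqMixin linf.
HB.instance Definition _ := gen_choiceMixin linf.

Lemma linf_ext (x y : linf) : (forall i, x i = y i) -> x = y.
Proof.
case: x y => [f fb] [g gb] /= fg.
have {fg} fg : f = g by exact: functional_extensionality_dep.
by case: g / fg gb => gb; congr Linf; exact: bool_irrelevance.
Qed.

Lemma linf0_subproof : `[< bounded_family (fun i => 0 : E i) >].
Proof. by apply/asboolP; exists 0 => i; rewrite rnorm0. Qed.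

Lemma linfN_subproof (x : linf) : `[< bounded_family (fun i => - x i) >].
Proof.
have /asboolP[M xM] := linf_bounded x.
by apply/asboolP; exists M => i; rewrite rnormN.
Qed.

Lemma linfD_subproof (x y : linf) : `[< bounded_family (fun i => x i + y i) >].
Proof.
have /asboolP[M xM] := linf_bounded x; have /asboolP[M' yM] := linf_bounded y.
apply/asboolP; exists (M + M') => i.
by rewrite (le_trans (rnormD _ _)) // lerD.
Qed.

Lemma linfZ_subproof (c : R[i]) (x : linf) : `[< bounded_family (fun i => c *: x i) >].
Proof.
have /asboolP[M xM] := linf_bounded x.
by apply/asboolP; exists (rnorm c * M) => i; rewrite rnormZ ler_wpM2l // rnorm_ge0.
Qed.

Definition linf0 := Linf linf0_subproof.
Definition linfN x := Linf (linfN_subproof x).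
Definition linfD x y := Linf (linfD_subproof x y).
Definition linfZ c x := Linf (linfZ_subproof c x).

Lemma linfDA : associative linfD.
Proof. by move=> x y z; apply: linf_ext => i; exact: addrA. Qed.
Lemma linfDC : commutative linfD.
Proof. by move=> x y; apply: linf_ext => i; exact: addrC. Qed.
Lemma linf0D : left_id linf0 linfD.
Proof. by move=> x; apply: linf_ext => i; exact: add0r. Qed.
Lemma linfND : left_inverse linf0 linfN linfD.
Proof. by move=> x; apply: linf_ext => i; exact: addNr. Qed.

HB.instance Definition _ := GRing.isZmodule.Build linf linfDA linfDC linf0D linfND.

Lemma linfZA a b x : linfZ a (linfZ b x) = linfZ (a * b) x.
Proof. by apply: linf_ext => i; exact: scalerA. Qed.
Lemma linf1Z : left_id 1 linfZ.
Proof. by move=> x; apply: linf_ext => i; exact: scale1r. Qed.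
Lemma linfZDr : right_distributive linfZ +%R.
Proof. by move=> a x y; apply: linf_ext => i; exact: scalerDr. Qed.
Lemma linfZDl x : {morph linfZ^~ x : a b / a + b}.
Proof. by move=> a b; apply: linf_ext => i; exact: scalerDl. Qed.

HB.instance Definition _ :=
  GRing.Zmodule_isLmodule.Build R[i] linf linfZA linf1Z linfZDr linfZDl.

(** Including 0 keeps the set nonempty when there are no indices. *)
Definition linf_norm (x : linf) : R :=
  sup [set r | r = 0 \/ exists i, r = rnorm (x i)].

Lemma linf_has_sup (x : linf) : has_sup [set r | r = 0 \/ exists i, r = rnorm (x i)].
Proof.
split; first by exists 0; left.
have /asboolP[M xM] := linf_bounded x.
exists `|M| => _ [->|[i ->]] //.
by rewrite (le_trans (xM i)) // ler_norm.
Qed.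

Lemma linf_coord (x : linf) i : rnorm (x i) <= linf_norm x.
Proof. by apply: (ub_le_sup (linf_has_sup x).2); right; exists i. Qed.

Lemma linf_norm_ge0 (x : linf) : 0 <= linf_norm x.
Proof. by apply: (ub_le_sup (linf_has_sup x).2); left. Qed.

Lemma linf_norm_le (x : linf) (M : R) : 0 <= M ->
  (forall i, rnorm (x i) <= M) -> linf_norm x <= M.
Proof.
move=> M0 xM; apply: ge_sup; first by exists 0; left.
by move=> _ [->|[i ->]].
Qed.

Let norm (x : linf) : R[i] := (linf_norm x)%:C.

Let ler_normD x y : norm (x + y) <= norm x + norm y.
Proof.
rewrite /norm -rmorphD lecR; apply: linf_norm_le => [|i].
  by rewrite addr_ge0 ?linf_norm_ge0.
by rewrite (le_trans (rnormD _ _)) // lerD ?linf_coord.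
Qed.

Let normZ c x : norm (c *: x) = `|c| * norm x.
Proof.
have le a y : linf_norm (a *: y) <= rnorm a * linf_norm y.
  apply: linf_norm_le => [|i]; first by rewrite mulr_ge0 ?rnorm_ge0 ?linf_norm_ge0.
  by rewrite [leLHS]rnormZ ler_wpM2l ?rnorm_ge0 ?linf_coord.
rewrite /norm -[`|c|]/((rnorm c)%:C) -rmorphM; congr (_%:C); apply/eqP.
rewrite eq_le le /=; have [->|c0] := eqVneq c 0.
  by rewrite rnorm0 mul0r linf_norm_ge0.
have rc : rnorm c * rnorm c^-1 = 1 by rewrite -rnormM divff // rnorm1.
have := le c^-1 (c *: x); rewrite scalerA mulVf // scale1r => h.
rewrite (le_trans (ler_wpM2l (rnorm_ge0 c) h)) // mulrA rc mul1r //.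
Qed.

Let norm0_eq0 x : norm x = 0 -> x = 0.
Proof.
move=> /(@complexI R) x0; apply: linf_ext => i.
by apply: rnorm_le0; rewrite -x0; exact: linf_coord.
Qed.

HB.instance Definition _ :=
  Lmodule_isNormed.Build R[i] linf ler_normD normZ norm0_eq0.

Lemma linf_normE (x : linf) : rnorm x = linf_norm x.
Proof. by []. Qed.

(** Coordinatewise limits exist by completeness of each E i; the Cauchy estimate
    is uniform in the coordinate, so it survives in the limit and gives both the
    boundedness of the limit family and the convergence in norm. *)
Lemma linf_complete (F : set_system linf) : ProperFilter F -> cauchy F -> cvg F.
Proof.
move=> FF /cauchy_ballP cF.
have small (e : R) : 0 < e ->
    exists2 A : set linf, F A & forall x y, A x -> A y -> rnorm (x - y) < e.
  move=> e0; have ec0 : (0 : R[i]) < e%:C by rewrite ltcR.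
  have [[A B] [/= FA FB] AB] := cF _ ec0.
  exists (A `&` B); first exact: filterI.
  move=> x y [Ax _] [_ By]; have := AB (x, y) (conj Ax By).
  by rewrite /= ball_rnormE.
have ci i : exists l : E i, (fun x : linf => x i) @ F --> l.
  apply/cvg_ex; apply: cauchy_cvg; apply/cauchy_ballP => e /gt0_complexE[-> e0].
  have [A FA Ae] := small _ e0.
  rewrite near_map2; exists (A, A) => //= -[x y] /= [Ax Ay].
  by rewrite ball_rnormE (le_lt_trans _ (Ae _ _ Ax Ay)) // (linf_coord (x - y) i).
pose l i := projT1 (cid (ci i)).
have lP i : (fun x : linf => x i) @ F --> l i := projT2 (cid (ci i)).
have lim_le (e : R) : 0 < e -> exists2 A : set linf, F A &
    forall x i, A x -> rnorm (l i - x i) <= e.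
  move=> e0; have [A FA Ae] := small _ e0; exists A => // x i Ax.
  apply/ler_addgt0Pr => e' e'0.
  have /cvg_rnormP/(_ _ e'0) Fe' := lP i.
  have [y [Ay /= ye']] := filter_ex (filterI FA Fe').
  have -> : l i - x i = (y i - x i) + (l i - y i) by rewrite [RHS]addrC addrA subrK.
  rewrite (le_trans (rnormD _ _)) // lerD //; last exact: ltW.
  by rewrite (le_trans (linf_coord (y - x) i)) // ltW // Ae.
have lb : `[< bounded_family l >].
  have [A FA A1] := lim_le _ (@ltr01 R); have [x Ax] := filter_ex FA.
  apply/asboolP; exists (1 + linf_norm x) => i.
  rewrite -[l i](subrK (x i)) (le_trans (rnormD _ _)) // lerD ?linf_coord //.
  exact: A1.
apply/cvg_ex; exists (Linf lb); apply/cvg_rnormP => e e0.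
have [A FA Ae] := lim_le _ (divr_gt0 e0 (@ltr0n R 2)).
apply: filterS FA => x Ax; rewrite linf_normE.
apply: (@le_lt_trans _ _ (e / 2)); last by rewrite ltr_pdivrMr // ltr_pMr // ltr1n.
apply: linf_norm_le => [|i]; first by rewrite divr_ge0 // ltW.
exact: (Ae x i Ax).
Qed.

HB.instance Definition _ := Uniform_isComplete.Build linf linf_complete.

Definition linf_proj (i : I) (x : linf) : E i := x i.

Lemma linf_proj_linear i : linear (linf_proj i).
Proof. by []. Qed.

HB.instance Definition _ i :=
  GRing.isLinear.Build R[i] linf (E i) *:%R (linf_proj i) (linf_proj_linear i).

Lemma linf_sumE (J : Type) (r : seq J) (f : J -> linf) i :
  (\sum_(j <- r) f j) i = \sum_(j <- r) f j i.
Proof. exact: (linear_sum (linf_proj i : {linear linf -> E i})). Qed.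

Lemma rnorm_linf_proj i x : rnorm (linf_proj i x) <= rnorm x.
Proof. exact: linf_coord. Qed.

Lemma linf_inj_subproof i (v : E i) :
  `[< bounded_family (eqtype.dfwith (fun j => 0 : E j) v) >].
Proof.
apply/asboolP; exists (rnorm v) => j.
by case: eqtype.dfwithP => [|j' _]; rewrite ?rnorm0 ?rnorm_ge0.
Qed.

Definition linf_inj i (v : E i) : linf := Linf (linf_inj_subproof v).

Lemma linf_inj_linear i : linear (@linf_inj i).
Proof.
move=> c u v; apply: linf_ext => j.
transitivity (c *: linf_inj u j + linf_inj v j); last by [].
have injE (w : E i) : linf_inj w j = eqtype.dfwith (fun j => 0 : E j) w j by [].
rewrite !injE; have [<-|ij] := eqVneq i j; first by rewrite !eqtype.dfwith_in.
by rewrite !eqtype.dfwith_out // scaler0 addr0.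
Qed.

HB.instance Definition _ i :=
  GRing.isLinear.Build R[i] (E i) linf *:%R (@linf_inj i) (@linf_inj_linear i).

Lemma rnorm_linf_inj i (v : E i) : rnorm (linf_inj v) <= rnorm v.
Proof.
apply: linf_norm_le => [|j]; first exact: rnorm_ge0.
by rewrite /=; case: eqtype.dfwithP => [|j' _]; rewrite ?rnorm0 ?rnorm_ge0.
Qed.

Section LinfMap.
Variables (F : normedModType R[i]) (T : forall i, {linear F -> E i}) (M : R).
Hypothesis TM : forall i x, rnorm (T i x) <= M * rnorm x.

Lemma linf_map_subproof x : `[< bounded_family (fun i => T i x) >].
Proof. by apply/asboolP; exists (M * rnorm x). Qed.

Definition linf_map x : linf := Linf (linf_map_subproof x).

Lemma linf_map_linear : linear linf_map.
Proof. by move=> c u v; apply: linf_ext => i; exact: linearP. Qed.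

HB.instance Definition _ :=
  GRing.isLinear.Build R[i] F linf *:%R linf_map linf_map_linear.

End LinfMap.

End LinfSum.

(** * Approximable operators *)
Section Approximable.
Variable R : realType.
Implicit Types E F G : normedModType R[i].

(** A pointwise form of the definition, which avoids suprema and contains the
    continuity of T. *)
Lemma approximableP E F (T : {linear E -> F}) :
  approximable T <-> forall e : R, 0 < e -> exists S : {linear E -> F},
    [/\ continuous S, finite_rank S & forall x, rnorm (T x - S x) <= e * rnorm x].
Proof.
split=> [[cT aT] e e0|aT].
  have [S [cS fS le]] := aT e e0; exists S; split=> // x.
  pose D : {linear E -> F} := T \- S.
  have [M M0 TM] := lin_bounded cT; have [M' M0' SM] := lin_bounded cS.
  have cD : continuous D.
    apply: (@lin_continuous _ _ _ D (M + M')) => y.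
    by rewrite /= (le_trans (rnormD _ _)) // rnormN mulrDl lerD.
  rewrite (le_trans (le_opnorm x cD)) // ler_wpM2r ?rnorm_ge0 // ltW //.
split=> [|e e0].
  have [S [cS _ TS]] := aT _ (@ltr01 R); have [M M0 SM] := lin_bounded cS.
  apply: (@lin_continuous _ _ _ T (1 + M)) => x.
  by rewrite -[T x](subrK (S x)) (le_trans (rnormD _ _)) // mulrDl lerD.
have e2 : 0 < e / 2 by rewrite divr_gt0.
have [S [cS fS le]] := aT _ e2; exists S; split=> //.
apply: (@le_lt_trans _ _ (e / 2)); first by apply: opnorm_le; rewrite ?(ltW e2).
by rewrite ltr_pdivrMr // ltr_pMr // ltr1n.
Qed.

Lemma approximable_finite_rank E F (T : {linear E -> F}) :
  continuous T -> finite_rank T -> approximable T.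
Proof.
move=> cT fT; apply/approximableP => e e0; exists T; split=> // x.
by rewrite subrr rnorm0 mulr_ge0 ?rnorm_ge0 ?(ltW e0).
Qed.

Lemma approximable_lim E F (T : {linear E -> F}) :
  (forall e : R, 0 < e -> exists2 S : {linear E -> F}, approximable S &
     forall x, rnorm (T x - S x) <= e * rnorm x) -> approximable T.
Proof.
move=> aT; apply/approximableP => e e0.
have e2 : 0 < e / 2 by rewrite divr_gt0.
have [S /approximableP/(_ _ e2)[S' [cS' fS' SS']] TS] := aT _ e2.
exists S'; split=> // x.
rewrite -[T x](subrK (S x)) -addrA (le_trans (rnormD _ _)) //.
by rewrite [e]splitr mulrDl lerD.
Qed.

Lemma approximableD E F (T T1 T2 : {linear E -> F}) :
  (forall x, T x = T1 x + T2 x) -> approximable T1 -> approximable T2 ->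
  approximable T.
Proof.
move=> TE /approximableP a1 /approximableP a2; apply/approximableP => e e0.
have e2 : 0 < e / 2 by rewrite divr_gt0.
have [S1 [c1 [s1 f1] b1]] := a1 _ e2; have [S2 [c2 [s2 f2] b2]] := a2 _ e2.
pose S : {linear E -> F} := S1 \+ S2.
exists S; split=> [x||x].
- by apply: cvgD; [exact: c1|exact: c2].
- exists (s1 ++ s2) => x; rewrite -[S x]/(S1 x + S2 x) -[S1 x]scale1r.
  apply: in_spanZD; [move: (f1 x)|move: (f2 x)]; apply: in_span_sub => y ys;
    by rewrite mem_cat ys ?orbT.
- have -> : T x - S x = (T1 x - S1 x) + (T2 x - S2 x).
    by rewrite TE opprD addrACA.
  by rewrite (le_trans (rnormD _ _)) // [e]splitr mulrDl lerD.
Qed.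

Lemma approximable_compl E F G (S : {linear F -> G}) (T : {linear E -> F}) :
  continuous S -> approximable T -> approximable (S \o T).
Proof.
move=> cS /approximableP aT; apply/approximableP => e e0.
have [M M0 SM] := lin_bounded cS.
have M1 : 0 < M + 1 by rewrite ltr_wpDl.
have [T' [cT' [s fT'] TT']] := aT _ (divr_gt0 e0 M1).
pose S' : {linear E -> G} := S \o T'.
exists S'; split=> [x||x].
- by apply: continuous_comp; [exact: cT'|exact: cS].
- by exists (map S s) => x; exact: in_span_map.
- rewrite [X in rnorm X](_ : _ = S (T x - T' x)); last by rewrite linearB.
  apply: (le_trans (SM _)).
  apply: (@le_trans _ _ ((M + 1) * (e / (M + 1) * rnorm x))).
    by rewrite ler_pM ?rnorm_ge0 ?lerDl.
  by rewrite !mulrA [_ * e]mulrC mulfK // gt_eqF.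
Qed.

Lemma approximable_compr E F G (S : {linear F -> G}) (T : {linear E -> F}) :
  continuous T -> approximable S -> approximable (S \o T).
Proof.
move=> cT /approximableP aS; apply/approximableP => e e0.
have [M M0 TM] := lin_bounded cT.
have M1 : 0 < M + 1 by rewrite ltr_wpDl.
have [S' [cS' [s fS'] SS']] := aS _ (divr_gt0 e0 M1).
pose S'' : {linear E -> G} := S' \o T.
exists S''; split=> [x||x].
- by apply: continuous_comp; [exact: cT|exact: cS'].
- by exists s => x; exact: fS'.
- apply: (le_trans (SS' _)).
  apply: (@le_trans _ _ (e / (M + 1) * ((M + 1) * rnorm x))).
    rewrite ler_wpM2l ?divr_ge0 ?(ltW e0) ?(ltW M1) // (le_trans (TM x)) //.
    by rewrite ler_wpM2r ?rnorm_ge0 ?lerDl.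
  by rewrite mulrA divfK // gt_eqF.
Qed.

End Approximable.

(** Approximable operators of norm at most 1, bundled with their target space so
    that a family of them with varying targets is a plain function. *)
Record approx_ball (R : realType) (E : completeNormedModType R[i]) := ApproxBall {
  ab_sp : completeNormedModType R[i];
  ab_op : {linear E -> ab_sp};
  ab_approx : approximable ab_op;
  ab_le1 : forall x, rnorm (ab_op x) <= rnorm x }.

(** The operator U sends x to the family of the c i *: t i x in the l_infinity sum
    of the targets. It is approximable: keeping finitely many coordinates leaves
    a finite sum of approximable operators, and the coordinates dropped have
    norm at most sup c i, which is as small as desired. *)
Lemma approx_join (R : realType) (I : eqType) (E : completeNormedModType R[i])
    (t : I -> approx_ball E) (c : I -> R) :
  (forall i, 0 <= c i <= 1) ->
  (forall e : R, 0 < e -> exists s : seq I, forall i, i \notin s -> c i <= e) ->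
  exists (U : approx_ball E) (p : forall i, {linear ab_sp U -> ab_sp (t i)}),
    (forall i y, rnorm (p i y) <= rnorm y) /\
    (forall i x, p i (ab_op U x) = (c i)%:C *: ab_op (t i) x).
Proof.
move=> c01 c_lim.
pose Esp i := ab_sp (t i).
pose T i : {linear E -> Esp i} := (c i)%:C \*: ab_op (t i).
have Tc i x : rnorm (T i x) <= c i * rnorm x.
  have /andP[c0 _] := c01 i.
  by rewrite [leLHS]rnormZ rnorm_real // ler_wpM2l // ab_le1.
have T1 i x : rnorm (T i x) <= 1 * rnorm x.
  have /andP[_ c1] := c01 i.
  by rewrite (le_trans (Tc i x)) // ler_wpM2r ?rnorm_ge0.
pose U : {linear E -> linf Esp} := linf_map T1.
have part (s : seq I) : exists2 S : {linear E -> linf Esp}, approximable S &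
    forall x, S x = \sum_(i <- s) linf_inj (T i x).
  elim: s => [|i s [S aS SE]].
    exists \0 => [|x]; last by rewrite big_nil.
    apply: approximable_finite_rank.
      by apply: (@lin_continuous _ _ _ _ 0) => x; rewrite rnorm0 mul0r.
    by exists [::] => x; exact: in_span0.
  pose S1 : {linear E -> linf Esp} := (@linf_inj _ _ Esp i) \o (T i).
  pose S2 : {linear E -> linf Esp} := S1 \+ S.
  exists S2 => [|x]; last by rewrite big_cons -SE.
  apply: (approximableD (T1 := S1) (T2 := S)) _ aS; first by [].
  apply: approximable_compl.
    exact: contraction_continuous (@rnorm_linf_inj _ _ Esp i).
  apply: (approximable_compl (S := GRing.scale (c i)%:C)).
    by apply: (@lin_continuous _ _ _ _ (rnorm (c i)%:C)) => x; rewrite rnormZ.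
  exact: ab_approx.
have coordE (s : seq I) x j : uniq s ->
    (\sum_(i <- s) linf_inj (T i x) : linf Esp) j = if j \in s then T j x else 0.
  move=> us; rewrite linf_sumE.
  have out i : i != j -> linf_inj (T i x) j = 0 :> Esp j.
    by move=> ij; rewrite /= eqtype.dfwith_out.
  have diag : linf_inj (T j x) j = T j x by rewrite /= eqtype.dfwith_in.
  case: ifPn => js.
    by rewrite (bigD1_seq j) // diag big1 => [|i ij]; [exact: addr0|exact: out].
  by rewrite big1_seq // => i /= is'; apply: out; apply: contraNneq js => <-.
have aU : approximable U.
  apply: approximable_lim => e e0; have [s sP] := c_lim e e0.
  have [S aS SE] := part (undup s); exists S => // x.
  apply: linf_norm_le => [|j]; first by rewrite mulr_ge0 ?rnorm_ge0 ?(ltW e0).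
  rewrite -[(U x - S x) j]/(T j x - S x j) SE coordE ?undup_uniq // mem_undup.
  case: ifPn => js; first by rewrite subrr rnorm0 mulr_ge0 ?rnorm_ge0 ?(ltW e0).
  by rewrite subr0 (le_trans (Tc j x)) // ler_wpM2r ?rnorm_ge0 // sP.
have U1 x : rnorm (U x) <= rnorm x.
  apply: linf_norm_le => [|j]; first exact: rnorm_ge0.
  by have := T1 j x; rewrite mul1r.
exists (ApproxBall aU U1), (fun i => @linf_proj _ _ Esp i); split=> // i y.
exact: rnorm_linf_proj.
Qed.

Lemma approx_pair (R : realType) (E : completeNormedModType R[i])
    (t1 t2 : approx_ball E) :
  exists (U : approx_ball E) (p1 : {linear ab_sp U -> ab_sp t1})
    (p2 : {linear ab_sp U -> ab_sp t2}),
    [/\ forall y, rnorm (p1 y) <= rnorm y, forall y, rnorm (p2 y) <= rnorm y,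
        forall x, p1 (ab_op U x) = ab_op t1 x & forall x, p2 (ab_op U x) = ab_op t2 x].
Proof.
have c01 (b : bool) : 0 <= (1 : R) <= 1 by rewrite ler01 lexx.
have [|U [p [p1 pE]]] := @approx_join _ _ E (fun b : bool => if b then t1 else t2) (fun=> 1) c01.
  by move=> e e0; exists [:: true; false] => -[].
exists U, (p true), (p false); split; try exact: p1.
  by move=> x; rewrite (pE true) scale1r.
by move=> x; rewrite (pE false) scale1r.
Qed.

(** A bounded functional has rank one, hence it is approximable, and it can be
    joined with t once it is divided by a bound M of its norm. *)
Lemma approx_pair_functional (R : realType) (E : completeNormedModType R[i])
    (g : {linear E -> R[i]}) (M : R) (t : approx_ball E) :
  0 < M -> (forall x, rnorm (g x) <= M * rnorm x) ->
  exists (U : approx_ball E) (q : {linear ab_sp U -> R[i]})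
    (p : {linear ab_sp U -> ab_sp t}),
    [/\ forall y, rnorm (q y) <= rnorm y, forall y, rnorm (p y) <= rnorm y,
        forall x, g x = M%:C * q (ab_op U x) & forall x, p (ab_op U x) = ab_op t x].
Proof.
move=> M0 gM.
pose h : {linear E -> R[i]} := M^-1%:C \*: g.
have hE x : h x = M^-1%:C * g x by [].
have h1 x : rnorm (h x) <= rnorm x.
  by rewrite hE rnormM rnorm_real ?invr_ge0 ?(ltW M0) // ler_pdivrMl.
have ah : approximable h.
  apply: approximable_finite_rank.
    by exact: contraction_continuous.
  by exists [:: 1] => x; exists (fun=> h x); rewrite big_ord1; exact: esym (mulr1 (h x)).
have [U [q [p [q1 p1 qE pE]]]] := approx_pair (ApproxBall ah h1) t.
exists U, q, p; split=> // x; rewrite qE /= complex_scaleE.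
by rewrite mulrA -rmorphM /= mulfV ?gt_eqF // mul1r.
Qed.

(** * Composition of an ideal with the approximable operators *)

(** For norms that are infima over factorizations. *)
Lemma le_mul_gt (R : realType) (K N X : R) : 0 <= K ->
  (forall r, N < r -> X <= K * r) -> X <= K * N.
Proof.
move=> K0 h; apply/ler_addgt0Pr => e e0.
have K1 : 0 < K + 1 by rewrite ltr_wpDl.
apply: (le_trans (h (N + e / (K + 1)) _)); first by rewrite ltrDl divr_gt0.
rewrite mulrDr lerD2l mulrCA ger_pMr // ler_pdivrMr // mul1r lerDl //.
Qed.

(** The ideal of all Q o T with Q in B and T approximable. For B the maximal hull
    of A this is, by definition, the minimal hull of A. *)
Definition comp_approx (R : realType) (k : nat) (B : poly_ideal R) : poly_ideal R :=
  {| pi_mem := fun E => [set P |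
       exists (E1 : completeNormedModType R[i]) (T : {linear E -> E1}) (Q : E1 -> R[i]),
         [/\ approximable T, pi_mem B E1 Q & P = Q \o T]];
     pi_norm := fun E P => inf [set r |
       exists (E1 : completeNormedModType R[i]) (T : {linear E -> E1}) (Q : E1 -> R[i]),
         [/\ approximable T, pi_mem B E1 Q, P = Q \o T &
             r = pi_norm B E1 Q * opnorm T ^+ k]] |}.

Section CompApprox.
Variables (R : realType) (k : nat) (B : poly_ideal R).
Hypotheses (k0 : (0 < k)%N) (bB : banach_ideal k B).
Implicit Types E F : completeNormedModType R[i].

Local Notation Bo := (comp_approx k B).

Lemma comp_norm_lb E P : lbound [set r |
       exists (E1 : completeNormedModType R[i]) (T : {linear E -> E1}) (Q : E1 -> R[i]),
         [/\ approximable T, pi_mem B E1 Q, P = Q \o T &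
             r = pi_norm B E1 Q * opnorm T ^+ k]] 0.
Proof.
move=> _ [E1 [T [Q [[cT _] mQ _ ->]]]].
by rewrite mulr_ge0 ?(ideal_norm_ge0 bB) // exprn_ge0 // opnorm_ge0.
Qed.

Lemma comp_norm_ge0 E P : pi_mem Bo E P -> 0 <= pi_norm Bo E P.
Proof.
move=> [E1 [T [Q [aT mQ PE]]]]; apply: lb_le_inf; last exact: comp_norm_lb.
by eexists; exists E1, T, Q; split.
Qed.

Lemma comp_mem E F (T : {linear E -> F}) Q : approximable T -> pi_mem B F Q ->
  pi_mem Bo E (Q \o T).
Proof. by move=> aT mQ; exists F, T, Q. Qed.

Lemma comp_norm_le E F (T : {linear E -> F}) Q (M : R) : approximable T ->
  pi_mem B F Q -> 0 <= M -> (forall x, rnorm (T x) <= M * rnorm x) ->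
  pi_norm Bo E (Q \o T) <= pi_norm B F Q * M ^+ k.
Proof.
move=> aT mQ M0 TM; apply: (@le_trans _ _ (pi_norm B F Q * opnorm T ^+ k)).
  apply: ge_inf; first by exists 0; exact: comp_norm_lb.
  by exists F, T, Q.
rewrite ler_wpM2l ?(ideal_norm_ge0 bB) // lerXn2r ?nnegrE ?opnorm_le //.
by rewrite opnorm_ge0 //; case: aT.
Qed.

Lemma comp_ball_mem E (t : approx_ball E) Q : pi_mem B (ab_sp t) Q ->
  pi_mem Bo E (Q \o ab_op t).
Proof. by move=> mQ; apply: comp_mem => //; exact: ab_approx. Qed.

Lemma comp_ball_le E (t : approx_ball E) Q : pi_mem B (ab_sp t) Q ->
  pi_norm Bo E (Q \o ab_op t) <= pi_norm B (ab_sp t) Q.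
Proof.
move=> mQ; have := comp_norm_le (ab_approx t) mQ ler01.
by rewrite expr1n mulr1; apply=> x; rewrite mul1r ab_le1.
Qed.

(** Replacing T by T / ||T|| and Q by ||T||^k Q does not change Q o T. If T = 0 then
    Q o T = 0, as k > 0, and Q = 0 serves. *)
Lemma comp_factor E P (r : R) : pi_mem Bo E P -> pi_norm Bo E P < r ->
  exists (t : approx_ball E) (Q : ab_sp t -> R[i]),
    [/\ pi_mem B (ab_sp t) Q, P = Q \o ab_op t & pi_norm B (ab_sp t) Q < r].
Proof.
move=> [E0 [T0 [Q0 [aT0 mQ0 PE0]]]] Pr.
have [|_ [E1 [T [Q [aT mQ PE ->]]]] lt] := inf_lt _ Pr.
  by exists (pi_norm B E0 Q0 * opnorm T0 ^+ k); exists E0, T0, Q0.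
have cT : continuous T by case: aT.
have [T_le0|T_gt0] := leP (opnorm T) 0.
  have T1 x : rnorm (T x) <= rnorm x.
    by rewrite (le_trans (le_opnorm x cT)) // (@le_trans _ _ 0) ?rnorm_ge0 // mulr_le0_ge0 ?rnorm_ge0.
  exists (ApproxBall aT T1), 0; split.
  - exact: (ideal0 bB).
  - rewrite PE; apply: funext => x /=.
    have -> : T x = 0.
      by apply: rnorm_le0; rewrite (le_trans (le_opnorm x cT)) // mulr_le0_ge0 ?rnorm_ge0.
    exact: hpoly_at0 k0 (ideal_hpoly bB mQ).
  - rewrite (ideal_norm0 bB) (le_lt_trans _ lt) //.
    by rewrite mulr_ge0 ?(ideal_norm_ge0 bB) // exprn_ge0 // opnorm_ge0.
pose c := (opnorm T)^-1.
have c0 : 0 < c by rewrite invr_gt0.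
pose T' : {linear E -> E1} := GRing.scale c%:C \o T.
have T'1 x : rnorm (T' x) <= rnorm x.
  by rewrite [leLHS]rnormZ rnorm_real ?(ltW c0) // ler_pdivrMl // le_opnorm.
have aT' : approximable T'.
  apply: approximable_compl aT.
  by apply: (@lin_continuous _ _ _ _ (rnorm c%:C)) => x; rewrite rnormZ.
exists (ApproxBall aT' T'1), ((opnorm T)%:C ^+ k *: Q); split.
- exact: (idealZ bB).
- rewrite PE; apply: funext => x /=.
  rewrite [RHS](_ : _ = (opnorm T)%:C ^+ k * Q (c%:C *: T x)); last by [].
  rewrite (hpoly_homog _ _ (ideal_hpoly bB mQ)) mulrA -exprMn -rmorphM /=.
  by rewrite mulfV ?gt_eqF // expr1n mul1r.
- rewrite (ideal_normZ bB _ mQ) rnormX rnorm_real ?(ltW T_gt0) //.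
  by rewrite mulrC.
Qed.

Lemma comp_bound E P x : pi_mem Bo E P ->
  rnorm (P x) <= pi_norm Bo E P * rnorm x ^+ k.
Proof.
move=> mP; have x0 : 0 <= rnorm x ^+ k by rewrite exprn_ge0 // rnorm_ge0.
rewrite mulrC; apply: le_mul_gt => // r Pr.
have [t [Q [mQ -> Qr]]] := comp_factor mP Pr.
rewrite (le_trans (ideal_bound bB (ab_op t x) mQ)) // mulrC.
apply: ler_pM; rewrite ?exprn_ge0 ?rnorm_ge0 ?(ideal_norm_ge0 bB) ?(ltW Qr) //.
by rewrite lerXn2r ?nnegrE ?rnorm_ge0 // ab_le1.
Qed.

(** With contractions t1 and t2 joined into U, the sum is (Q1 o p1 + Q2 o p2) o U,
    and the norms of Q1 o p1 and Q2 o p2 are below r1 and r2. *)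
Lemma comp_add E P1 P2 : pi_mem Bo E P1 -> pi_mem Bo E P2 ->
  pi_mem Bo E (P1 + P2) /\
  pi_norm Bo E (P1 + P2) <= pi_norm Bo E P1 + pi_norm Bo E P2.
Proof.
move=> m1 m2.
have key r1 r2 : pi_norm Bo E P1 < r1 -> pi_norm Bo E P2 < r2 ->
    pi_mem Bo E (P1 + P2) /\ pi_norm Bo E (P1 + P2) <= r1 + r2.
  move=> /(comp_factor m1)[t1 [Q1 [mQ1 PE1 Qr1]]] /(comp_factor m2)[t2 [Q2 [mQ2 PE2 Qr2]]].
  have [U [p1 [p2 [b1 b2 E1 E2]]]] := approx_pair t1 t2.
  have c1 : continuous p1 by exact: contraction_continuous.
  have c2 : continuous p2 by exact: contraction_continuous.
  have mQ1' := ideal_comp bB c1 mQ1; have mQ2' := ideal_comp bB c2 mQ2.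
  pose S1 : ab_sp U -> R[i] := Q1 \o p1; pose S2 : ab_sp U -> R[i] := Q2 \o p2.
  have -> : P1 + P2 = (S1 + S2) \o ab_op U.
    by apply: funext => x; rewrite PE1 PE2 /S1 /S2 /= !fctE /= E1 E2.
  have mQ := idealD bB mQ1' mQ2'; split; first exact: comp_ball_mem.
  rewrite (le_trans (comp_ball_le mQ)) // (le_trans (ideal_normD bB mQ1' mQ2')) //.
  rewrite lerD //.
    by rewrite (le_trans (ideal_comp_le1 bB b1 mQ1)) // ltW.
  by rewrite (le_trans (ideal_comp_le1 bB b2 mQ2)) // ltW.
split.
  by apply: (key (pi_norm Bo E P1 + 1) (pi_norm Bo E P2 + 1) _ _).1; rewrite ltrDl.
apply/ler_addgt0Pr => e e0; have e2 : 0 < e / 2 by rewrite divr_gt0.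
rewrite [e]splitr addrACA; apply: (key _ _ _ _).2; by rewrite ltrDl.
Qed.

Lemma comp_scale E c P : pi_mem Bo E P ->
  pi_mem Bo E (c *: P) /\ pi_norm Bo E (c *: P) <= rnorm c * pi_norm Bo E P.
Proof.
move=> mP.
have key r : pi_norm Bo E P < r ->
    pi_mem Bo E (c *: P) /\ pi_norm Bo E (c *: P) <= rnorm c * r.
  move=> /(comp_factor mP)[t [Q [mQ -> Qr]]].
  have mcQ := idealZ bB c mQ.
  split; first exact: (comp_ball_mem mcQ).
  rewrite (le_trans (comp_ball_le mcQ)) // (ideal_normZ bB _ mQ).
  by rewrite ler_wpM2l ?rnorm_ge0 // ltW.
split; first by apply: (key (pi_norm Bo E P + 1) _).1; rewrite ltrDl.
by apply: le_mul_gt => [|r /key[]]; rewrite ?rnorm_ge0.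
Qed.

Lemma comp_norm0 E : pi_mem Bo E 0 /\ pi_norm Bo E 0 = 0.
Proof.
have a0 : approximable (\0 : {linear E -> E}).
  apply: approximable_finite_rank.
    by apply: (@lin_continuous _ _ _ _ 0) => x; rewrite rnorm0 mul0r.
  by exists [::] => x; exact: in_span0.
have m0 := comp_mem a0 (ideal0 bB E); split=> //.
have := comp_norm_le (M := 0) a0 (ideal0 bB E) (lexx _).
rewrite (ideal_norm0 bB) mul0r => h.
apply/eqP; rewrite eq_le comp_norm_ge0 // andbT; apply: h => x.
by rewrite rnorm0 mul0r.
Qed.

End CompApprox.

(** * Completeness of the composition ideal *)
Section GeometricSum.
Variables (R : realType) (k : nat) (B : poly_ideal R).
Hypothesis bB : banach_ideal k B.

Lemma ideal_geometric_series (F : completeNormedModType R[i]) (q : nat -> F -> R[i]) :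
  (forall j, pi_mem B F (q j)) -> (forall j, pi_norm B F (q j) <= 2^-1 ^+ j) ->
  exists2 S, pi_mem B F S &
    pi_norm B F (\sum_(j < n) q j - S) @[n --> \oo] --> (0 : R).
Proof.
move=> mq lq; pose S n := \sum_(j < n) q j.
have S1 n : S n.+1 = S n + q n by rewrite /S big_ord_recr.
have mS n : pi_mem B F (S n).
  elim: n => [|n IH]; first by rewrite /S big_ord0; exact: (ideal0 bB).
  by rewrite S1; exact: (idealD bB).
have dS n d : pi_norm B F (S (n + d)%N - S n) <= 2 * (2^-1 ^+ n - 2^-1 ^+ (n + d)).
  elim: d => [|d IH].
    by rewrite addn0 !subrr mulr0 (ideal_norm0 bB).
  rewrite addnS S1 addrAC (le_trans (ideal_normD bB (idealB bB (mS _) (mS _)) (mq _))) //.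
  rewrite (le_trans (lerD IH (lq _))) // [in leRHS]exprS; lra.
have half n m : (n <= m)%N -> pi_norm B F (S m - S n) <= 2 * 2^-1 ^+ n.
  move=> nm; have := dS n (m - n)%N; rewrite subnKC // => /le_trans; apply.
  by rewrite ler_wpM2l // gerBl exprn_ge0 // invr_ge0.
apply: (ideal_complete bB mS) => e e0.
have e4 : 0 < e / 4 by rewrite divr_gt0.
have [n0 n0P] : exists n0 : nat, (2^-1 : R) ^+ n0 < e / 4.
  have : (fun n => (2^-1 : R) ^+ n) @ \oo --> (0 : R).
    by apply: cvg_expr; rewrite ger0_norm ?invr_ge0 // invf_lt1 // ltr1n.
  move=> /cvgrPdist_lt/(_ _ e4)[n0 _ /(_ n0 (leqnn _))].
  rewrite /= sub0r normrN ger0_norm ?exprn_ge0 ?invr_ge0 // => h; by exists n0.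
exists n0 => m n n0m n0n.
have -> : S m - S n = (S m - S n0) - (S n - S n0) by rewrite opprB addrA subrK.
rewrite (le_lt_trans (ideal_normB bB (idealB bB (mS _) (mS _)) (idealB bB (mS _) (mS _)))) //.
by have := half _ _ n0m; have := half _ _ n0n; lra.
Qed.

End GeometricSum.

Section CompBanach.
Variables (R : realType) (k : nat) (B : poly_ideal R).
Hypotheses (k0 : (0 < k)%N) (bB : banach_ideal k B).
Implicit Types E F : completeNormedModType R[i].

Local Notation Bo := (comp_approx k B).

(** Write P j = Q j o t j with contractions t j, and join the t j with weights
    c j = 2^-j. Undoing the weight multiplies Q j by 2^(jk), and the bound
    4^(-jk) on its norm still leaves 2^(-jk), so that these polynomials are
    summable on the joint target; composing with the joint operator sums the
    P j. *)
Lemma comp_series E (P : nat -> E -> R[i]) :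
  (forall j, pi_mem Bo E (P j)) ->
  (forall j, pi_norm Bo E (P j) < (4^-1 ^+ j) ^+ k) ->
  exists2 Q, pi_mem Bo E Q & forall e : R, 0 < e -> exists n0, forall n, (n0 <= n)%N ->
    pi_mem Bo E (\sum_(j < n) P j - Q) /\ pi_norm Bo E (\sum_(j < n) P j - Q) <= e.
Proof.
move=> mP lP.
have /boolp.choice[f fP] : forall j, exists tQ : {t : approx_ball E & ab_sp t -> R[i]},
    [/\ pi_mem B (ab_sp (projT1 tQ)) (projT2 tQ), P j = projT2 tQ \o ab_op (projT1 tQ) &
        pi_norm B (ab_sp (projT1 tQ)) (projT2 tQ) < (4^-1 ^+ j) ^+ k].
  move=> j; have [t [Q [mQ PE lt]]] := comp_factor k0 bB (mP j) (lP j).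
  by exists (existT _ t Q).
pose c (j : nat) : R := 2^-1 ^+ j.
have c0 j : 0 < c j by rewrite exprn_gt0 // invr_gt0.
have c01 j : 0 <= c j <= 1.
  by rewrite (ltW (c0 j)) exprn_ile1 // ?invr_ge0 // invf_le1 // ler1n.
have c_lim (e : R) : 0 < e -> exists s : seq nat, forall i, i \notin s -> c i <= e.
  move=> e0.
  have : (fun n => (2^-1 : R) ^+ n) @ \oo --> (0 : R).
    by apply: cvg_expr; rewrite ger0_norm ?invr_ge0 // invf_lt1 // ltr1n.
  move=> /cvgrPdist_le/(_ _ e0)[n0 _ n0P]; exists (iota 0 n0) => i.
  rewrite mem_iota add0n -leqNgt => /n0P.
  by rewrite /= sub0r normrN ger0_norm // ltW // c0.
have [U [p [p1 pE]]] := @approx_join _ _ E (fun j => projT1 (f j)) c c01 c_lim.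
have cp j : continuous (p j) by exact: contraction_continuous.
pose q j : ab_sp U -> R[i] := ((c j)^-1%:C ^+ k) *: (projT2 (f j) \o p j).
have mfp j : pi_mem B (ab_sp U) (projT2 (f j) \o p j).
  by apply: (ideal_comp bB) => //; case: (fP j).
have mq j : pi_mem B (ab_sp U) (q j) by exact: (idealZ bB).
have lq j : pi_norm B (ab_sp U) (q j) <= 2^-1 ^+ j.
  have [mf _ lf] := fP j.
  rewrite (ideal_normZ bB _ (mfp j)) rnormX rnorm_real ?invr_ge0 ?(ltW (c0 j)) //.
  apply: (@le_trans _ _ (((c j)^-1) ^+ k * (4^-1 ^+ j) ^+ k)).
    rewrite ler_wpM2l ?exprn_ge0 ?invr_ge0 ?(ltW (c0 j)) //.
    by rewrite (le_trans (ideal_comp_le1 bB (p1 j) mf)) // ltW.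
  have -> : (4^-1 : R) ^+ j = c j * c j by rewrite /c -exprMn -invfM -natrM.
  rewrite -exprMn mulrA mulVf ?gt_eqF // mul1r.
  by rewrite -[leRHS]expr1 ler_wiXn2l ?(ltW (c0 j)) //; case/andP: (c01 j).
have [S mS Slim] := ideal_geometric_series bB mq lq.
have sumE n : \sum_(j < n) P j = (\sum_(j < n) q j) \o ab_op U.
  elim: n => [|n IH]; first by rewrite !big_ord0.
  rewrite !big_ord_recr IH /=; apply: funext => x; rewrite !fctE /= /q; congr (_ + _).
  have [mf -> _] := fP n.
  rewrite [RHS](_ : _ = (c n)^-1%:C ^+ k * projT2 (f n) (p n (ab_op U x))); last by [].
  rewrite pE (hpoly_homog _ _ (ideal_hpoly bB mf)) mulrA -exprMn -rmorphM /=.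
  by rewrite mulVf ?gt_eqF // expr1n mul1r.
have msum n : pi_mem B (ab_sp U) (\sum_(j < n) q j).
  elim: n => [|n IH]; first by rewrite big_ord0; exact: (ideal0 bB).
  by rewrite big_ord_recr; exact: (idealD bB).
exists (S \o ab_op U); first exact: comp_ball_mem.
move=> e e0; move/cvgrPdist_le: Slim => /(_ _ e0)[n0 _ n0P]; exists n0 => n /n0P /=.
have md := idealB bB (msum n) mS.
rewrite sub0r normrN ger0_norm ?(ideal_norm_ge0 bB) // => le.
pose D : ab_sp U -> R[i] := \sum_(j < n) q j - S.
have -> : \sum_(j < n) P j - (S \o ab_op U : E -> R[i]) = D \o ab_op U.
  by rewrite sumE.
split; first exact: comp_ball_mem.
exact: le_trans (comp_ball_le bB md) le.
Qed.

(** A fast subsequence u (G j) has differences that satisfy the hypothesis of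
    [comp_series]. *)
Lemma comp_complete E (u : nat -> E -> R[i]) : (forall n, pi_mem Bo E (u n)) ->
  (forall e : R, 0 < e -> exists n0 : nat, forall m n : nat,
     (n0 <= m)%N -> (n0 <= n)%N -> pi_norm Bo E (u m - u n) < e) ->
  exists2 P, pi_mem Bo E P & pi_norm Bo E (u n - P) @[n --> \oo] --> (0 : R).
Proof.
move=> mu cu.
have mD P Q : pi_mem Bo E P -> pi_mem Bo E Q -> pi_mem Bo E (P + Q).
  by move=> mP mQ; exact: (comp_add k0 bB mP mQ).1.
have mB P Q : pi_mem Bo E P -> pi_mem Bo E Q -> pi_mem Bo E (P - Q).
  by move=> mP mQ; apply: mD => //; rewrite -scaleN1r; exact: (comp_scale k0 bB _ mQ).1.
have /boolp.choice[g gP] : forall j : nat, exists n0 : nat, forall m n : nat,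
    (n0 <= m)%N -> (n0 <= n)%N -> pi_norm Bo E (u m - u n) < (4^-1 ^+ j) ^+ k.
  by move=> j; apply: cu; rewrite !exprn_gt0 // invr_gt0.
(* at least g j and j, and nondecreasing *)
pose G j := (j + \sum_(i < j.+1) g i)%N.
have gG j : (g j <= G j)%N.
  by rewrite /G big_ord_recr /= addnA leq_addl.
have GS j : (G j <= G j.+1)%N.
  by rewrite /G [in leqRHS]big_ord_recr /= leq_add // leq_addr.
pose P j : E -> R[i] := u (G j.+1) - u (G j).
have [] := @comp_series E P.
- by move=> j; exact: mB.
- by move=> j; apply: gP => //; exact: leq_trans (gG j) (GS j).
move=> Q mQ Qlim.
have tele n : \sum_(j < n) P j = u (G n) - u (G 0).
  elim: n => [|n IH]; first by rewrite big_ord0 subrr.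
  by rewrite big_ord_recr /= IH /P; apply: funext => x; rewrite !fctE; ring.
exists (Q + u (G 0)); first exact: mD.
apply/cvgrPdist_le => e e0; have e2 : 0 < e / 2 by rewrite divr_gt0.
have [n0 n0P] := cu _ e2; have [n1 n1P] := Qlim _ e2.
exists n0 => // n /= n0n.
pose m := maxn n0 n1.
have mG : (n0 <= G m)%N by rewrite (leq_trans (leq_maxl n0 n1)) // leq_addr.
have [ms ls] := n1P m (leq_maxr _ _).
rewrite sub0r normrN ger0_norm; last first.
  by apply: (comp_norm_ge0 bB); apply: mB => //; exact: mD.
have -> : u n - (Q + u (G 0)) = (u n - u (G m)) + (\sum_(j < m) P j - Q).
  by rewrite tele; apply: funext => x; rewrite !fctE; ring.
rewrite (le_trans (comp_add k0 bB (mB _ _ (mu n) (mu _)) ms).2) //.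
by rewrite [e]splitr lerD // ltW // n0P.
Qed.

Lemma comp_banach : banach_ideal k Bo.
Proof.
split.
- move=> E; split.
    move=> _ [F [T [Q [[cT _] mQ ->]]]].
    exact: (hpoly_comp cT (ideal_hpoly bB mQ)).
  split.
  + split; first exact: (comp_norm0 bB E).1.
      by move=> P Q mP mQ; exact: (comp_add k0 bB mP mQ).1.
    by move=> c P mP; exact: (comp_scale k0 bB c mP).1.
  + split; first by move=> P; exact: comp_norm_ge0.
    * move=> P mP N0; apply: funext => x; apply: rnorm_le0.
      by have := comp_bound k0 bB x mP; rewrite N0 mul0r.
    * by apply: norm_homog_of_le => [P|c P]; [exact: comp_norm_ge0|exact: comp_scale].
    * by move=> P Q mP mQ; exact: (comp_add k0 bB mP mQ).2.
  + by move=> u; exact: comp_complete.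
- move=> E F T P cT mP; split.
    case: mP => G [S [Q [aS mQ ->]]].
    by exists G, (S \o T), Q; split=> //; exact: approximable_compr.
  rewrite mulrC; apply: le_mul_gt => [|r Pr]; first by rewrite exprn_ge0 // opnorm_ge0.
  have [t [Q [mQ -> Qr]]] := comp_factor k0 bB mP Pr.
  have tT x : rnorm (ab_op t (T x)) <= opnorm T * rnorm x.
    by rewrite (le_trans (ab_le1 _ _)) // le_opnorm.
  pose tT' : {linear E -> ab_sp t} := ab_op t \o T.
  have := comp_norm_le (T := tT') bB (approximable_compr cT (ab_approx t)) mQ (opnorm_ge0 cT) tT.
  move=> /le_trans; apply; rewrite mulrC.
  by rewrite ler_wpM2l ?exprn_ge0 ?opnorm_ge0 // ltW.
- have [_ _ [mz nz]] := bB.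
  pose T : {linear R[i] -> R[i]} := idfun.
  have T1 x : rnorm (T x) <= 1 * rnorm x by rewrite mul1r.
  have aT : approximable T.
    apply: approximable_finite_rank; first exact: lin_continuous T1.
    by exists [:: 1] => x; exists (fun=> x); rewrite big_ord1; exact: esym (mulr1 x).
  have m : pi_mem Bo R[i] (fun z => z ^+ k) by exists R[i], T, (fun z => z ^+ k).
  split=> //; apply/eqP; rewrite eq_le; apply/andP; split.
    have := comp_norm_le bB aT mz ler01 T1.
    by rewrite nz expr1n mulr1.
  by have := comp_bound k0 bB (1 : R[i]) m; rewrite expr1n rnorm1 expr1n mulr1.
Qed.

End CompBanach.

(** * Multiplicativity of the composition ideals *)
Section CompSequence.
Variables (R : realType) (B : nat -> poly_ideal R).

Local Notation Bo := (fun k => comp_approx k (B k)).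

(** Differentiation passes through the factorization, (Q o t)_a = Q_(t a) o t.
    For a functional g with ||g|| < M, the operators g / M and t are joined into U,
    and g * (Q o t) = M (q * (Q o p)) o U for the contractive projections q, p. *)
Lemma comp_coherent : coherent B -> coherent Bo.
Proof.
move=> [bB [C [D [C0 D0 cB]]]]; split=> [k k0|]; first exact: comp_banach (bB k k0).
exists C, D; split; [exact: C0|exact: D0|] => E k k0.
have bk := bB k k0; have bk1 := bB k.+1 isT; split=> [P a mP|P g cg mP].
  have key r : pi_norm (Bo k.+1) E P < r ->
      pi_mem (Bo k) E (poly_at k P a) /\
      pi_norm (Bo k) E (poly_at k P a) <= C * rnorm a * r.
    move=> /(comp_factor (ltn0Sn k) bk1 mP)[t [Q [mQ -> Qr]]].
    have hQ := ideal_hpoly bk1 mQ; have [ct _] := ab_approx t.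
    rewrite (poly_at_comp a ct hQ).
    have [/(_ _ (ab_op t a) mQ)[ma lea] _] := cB (ab_sp t) k k0.
    split; first exact: comp_ball_mem.
    rewrite (le_trans (comp_ball_le bk ma)) // (le_trans lea) // mulrAC.
    apply: ler_pM; rewrite ?mulr_ge0 ?rnorm_ge0 ?(ltW C0) ?(ideal_norm_ge0 bk1) ?(ltW Qr) //.
    by rewrite ler_wpM2l ?(ltW C0) // ab_le1.
  split; first by apply: (key (pi_norm (Bo k.+1) E P + 1) _).1; rewrite ltrDl.
  rewrite mulrAC; apply: le_mul_gt => [|r /key[]//].
  by rewrite mulr_ge0 ?rnorm_ge0 ?(ltW C0).
have key M r : opnorm g < M -> pi_norm (Bo k) E P < r ->
    pi_mem (Bo k.+1) E (fun x => g x * P x) /\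
    pi_norm (Bo k.+1) E (fun x => g x * P x) <= D * r * M.
  move=> gM /(comp_factor k0 bk mP)[t [Q [mQ PE Qr]]].
  have M0 : 0 < M := le_lt_trans (opnorm_ge0 cg) gM.
  have gMx x : rnorm (g x) <= M * rnorm x.
    by rewrite (le_trans (le_opnorm x cg)) // ler_wpM2r ?rnorm_ge0 // ltW.
  have [U [q [p [q1 p1 qE pE]]]] := approx_pair_functional t M0 gMx.
  have cq : continuous q by exact: contraction_continuous.
  have cp : continuous p by exact: contraction_continuous.
  have mQp := ideal_comp bk cp mQ.
  have [_ /(_ _ q cq mQp)[mS leS]] := cB (ab_sp U) k k0.
  pose S : ab_sp U -> R[i] := fun y => q y * (Q \o p) y.
  have -> : (fun x => g x * P x) = (M%:C *: S : ab_sp U -> R[i]) \o ab_op U.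
    apply: funext => x; rewrite PE.
    rewrite [RHS](_ : _ = M%:C * (q (ab_op U x) * Q (p (ab_op U x)))); last by [].
    by rewrite mulrA -qE pE.
  have mS' : pi_mem (B k.+1) (ab_sp U) S by exact: mS.
  have mMS := idealZ bk1 M%:C mS'; split; first exact: comp_ball_mem mMS.
  rewrite (le_trans (comp_ball_le bk1 mMS)) // (ideal_normZ bk1 _ mS').
  rewrite rnorm_real ?(ltW M0) // mulrC ler_wpM2r ?(ltW M0) // (le_trans leS) //.
  rewrite -mulrA ler_wpM2l ?(ltW D0) // -[leRHS]mul1r ler_pM //.
  - exact: opnorm_ge0.
  - exact: (ideal_norm_ge0 bk).
  - by apply: opnorm_le => // x; rewrite mul1r.
  - by rewrite (le_trans (ideal_comp_le1 bk p1 mQ)) // ltW.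
split.
  by apply: (key (opnorm g + 1) (pi_norm (Bo k) E P + 1) _ _).1; rewrite ltrDl.
apply: le_mul_gt => [|r Pr]; first by rewrite mulr_ge0 ?opnorm_ge0 ?(ltW D0).
rewrite mulrAC; apply: le_mul_gt => [|M gM].
  rewrite mulr_ge0 ?(ltW D0) // (le_trans _ (ltW Pr)) //.
  exact: (comp_norm_ge0 bk).
exact: (key M r gM Pr).2.
Qed.

Lemma comp_multiplicative : multiplicative B -> multiplicative Bo.
Proof.
move=> [coB [M mB]]; split; first exact: comp_coherent.
have [bB _] := coB.
exists `|M| => k l k0 l0 E P Q mP mQ; have bk := bB _ k0; have bl := bB _ l0.
have kl0 : (0 < k + l)%N by rewrite addn_gt0 k0.
have bkl := bB _ kl0.
have M0 : 0 <= `|M| ^+ (k + l) by rewrite exprn_ge0.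
have key r s : pi_norm (Bo k) E P < r -> pi_norm (Bo l) E Q < s ->
    pi_mem (Bo (k + l)%N) E (fun x => P x * Q x) /\
    pi_norm (Bo (k + l)%N) E (fun x => P x * Q x) <= `|M| ^+ (k + l) * s * r.
  move=> /(comp_factor k0 bk mP)[t1 [P1 [mP1 PE Pr]]].
  move=> /(comp_factor l0 bl mQ)[t2 [Q1 [mQ1 QE Qs]]].
  have [U [p1 [p2 [b1 b2 E1 E2]]]] := approx_pair t1 t2.
  have c1 : continuous p1 by exact: contraction_continuous.
  have c2 : continuous p2 by exact: contraction_continuous.
  have mP' := ideal_comp bk c1 mP1; have mQ' := ideal_comp bl c2 mQ1.
  have [mS leS] := mB _ _ k0 l0 _ _ _ mP' mQ'.
  pose S : ab_sp U -> R[i] := fun y => (P1 \o p1) y * (Q1 \o p2) y.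
  have mS' : pi_mem (B (k + l)%N) (ab_sp U) S by exact: mS.
  have -> : (fun x => P x * Q x) = S \o ab_op U.
    by apply: funext => x; rewrite PE QE /S /= E1 E2.
  split; first exact: comp_ball_mem mS'.
  rewrite (le_trans (comp_ball_le bkl mS')) // (le_trans leS) //.
  have P0 := ideal_norm_ge0 bk mP'; have Q0 := ideal_norm_ge0 bl mQ'.
  have Pr' : pi_norm (B k) (ab_sp U) (P1 \o p1) <= r.
    by rewrite (le_trans (ideal_comp_le1 bk b1 mP1)) // ltW.
  have Qs' : pi_norm (B l) (ab_sp U) (Q1 \o p2) <= s.
    by rewrite (le_trans (ideal_comp_le1 bl b2 mQ1)) // ltW.
  rewrite -!mulrA [s * r]mulrC.
  apply: (@le_trans _ _ (`|M| ^+ (k + l) *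
      (pi_norm (B k) (ab_sp U) (P1 \o p1) * pi_norm (B l) (ab_sp U) (Q1 \o p2)))).
    by rewrite ler_wpM2r ?mulr_ge0 // -normrX ler_norm.
  by rewrite ler_wpM2l // ler_pM.
split.
  by apply: (key (pi_norm (Bo k) E P + 1) (pi_norm (Bo l) E Q + 1) _ _).1; rewrite ltrDl.
apply: le_mul_gt => [|s Qs].
  by rewrite mulr_ge0 // (comp_norm_ge0 bk).
rewrite mulrAC; apply: le_mul_gt => [|r Pr].
  by rewrite mulr_ge0 // (le_trans _ (ltW Qs)) // (comp_norm_ge0 bl).
exact: (key r s Pr Qs).2.
Qed.

End CompSequence.

Theorem corollary2p8 (R : realType) (A : nat -> poly_ideal R)
    (hA : multiplicative A) :
  multiplicative (fun k => min_hull k (A k)) /\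
  multiplicative (fun k => max_hull k (A k)).
Proof.
have max := max_multiplicative hA.
split; last exact: max.
exact: (comp_multiplicative max).
Qed.
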